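(* There exists a positive constant $c$ depending only on the ratio $c_1/c_2$ such that for every $\phi_0 \in \mathcal{C}$, $r > 0$ and $\epsilon > 0$, we have $$\log M(\epsilon, S(\phi_0, r), \ell) \leq c \left(\log\frac{en}{2c_1}\right)^{5/4}\sqrt{\frac{\Gamma(r;\phi_0)}{\epsilon}}$$ where $$\Gamma(r;\phi_0) := \inf_{\alpha\in\mathcal{P}}\left(k^{5/2}(\alpha)\left(r^2 + \ell^2(\phi_0,\alpha)\right)^{1/2}\right).$$
   Context: Let $\mathcal{C}$ denote the set of all real-valued convex functions on $[0,1]$. Let $n \ge 2$ and let $x_1 < x_2 < \dots < x_n$ be fixed design points in $[0,1]$ satisfying $c_1 \le n(x_i - x_{i-1}) \le c_2$ for $i = 2, \dots, n$, where $c_1, c_2$ are positive constants. For real functions $\phi,\psi$ on $[0,1]$, $\ell^2(\phi,\psi) := \frac1n\sum_{i=1}^n(\phi(x_i)-\psi(x_i))^2$, and $\ell$ (a pseudometric) is its nonnegative square root. For $r>0$, $S(\phi_0,r) := \{\phi\in\mathcal{C} : \ell^2(\phi,\phi_0)\le r^2\}$. For a subset $\mathcal{F}$ of a (pseudo)metric space $(\mathcal{X},\rho)$, the covering number $M(\epsilon,\mathcal{F},\rho)$ is the smallest number of closed balls of radius $\epsilon$ whose union contains $\mathcal{F}$. A convex function $\alpha$ on $[0,1]$ is piecewise affine if there are an integer $k$ and points $0 = t_0 < t_1 < \dots < t_k = 1$ such that $\alpha$ is affine on each interval $[t_{i-1},t_i]$, $i=1,\dots,k$; $k(\alpha)$ is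 the smallest such $k$, and $k^{5/2}(\alpha) = (k(\alpha))^{5/2}$. $\mathcal{P}$ is the collection of all piecewise affine convex functions on $[0,1]$. *)

(* Defs.v *)
From HB Require Import structures.
From mathcomp Require Import all_boot all_order all_algebra.
From mathcomp Require Import all_classical all_reals all_analysis.
Set Implicit Arguments.
Unset Strict Implicit.
Unset Printing Implicit Defensive.
Import Order.TTheory GRing.Theory Num.Theory.
Import numFieldNormedType.Exports.
Local Open Scope classical_set_scope.
Local Open Scope ring_scope.

(* A real function on [0,1] is represented by a function R -> R of which only
   the values on [0,1] are ever constrained or used. *)

Section ConvexRegression.
Variable R : realType.
Implicit Types (phi psi alpha : R -> R).

Definition convex01 : set (R -> R) :=
  [set phi | @convex_function R R^o `[0, 1]%classic phi].

Definition ell2 n (x : 'I_n -> R) phi psi : R :=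
  n%:R^-1 * \sum_(i < n) (phi (x i) - psi (x i)) ^+ 2.

Definition ell n (x : 'I_n -> R) phi psi : R := Num.sqrt (ell2 x phi psi).

Definition convex_ball n (x : 'I_n -> R) phi0 (r : R) : set (R -> R) :=
  [set phi | convex01 phi /\ ell2 x phi phi0 <= r ^+ 2].

(* The centers range over the whole ambient space X, not only over F. *)
Definition covered_by (X : Type) (rho : X -> X -> R) (eps : R) (F : set X)
    (N : nat) : Prop :=
  exists c : 'I_N -> X, F `<=` \bigcup_i [set y | rho (c i) y <= eps].

(* Equal to +oo when no finite cover exists; the infimum of a nonempty set of
   natural numbers is attained. *)
Definition covering_number (X : Type) (eps : R) (F : set X)
    (rho : X -> X -> R) : \bar R :=
  ereal_inf [set (N%:R)%:E | N in covered_by rho eps F].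

Definition affine_on (a b : R) alpha : Prop :=
  exists p q : R, forall y, a <= y <= b -> alpha y = p * y + q.

Definition has_affine_pieces alpha (k : nat) : Prop :=
  exists t : nat -> R, [/\ t 0%N = 0, t k = 1,
    forall i, (i < k)%N -> t i < t i.+1 &
    forall i, (i < k)%N -> affine_on (t i) (t i.+1) alpha].

Definition pw_affine_convex : set (R -> R) :=
  [set alpha | convex01 alpha /\ exists k, has_affine_pieces alpha k].

(* The least k such that has_affine_pieces alpha k; the junk value 0 is only
   taken when alpha is not piecewise affine. *)
Definition num_pieces alpha : nat :=
  xget 0%N [set k | has_affine_pieces alpha k /\
                    forall m, has_affine_pieces alpha m -> (k <= m)%N].

Definition Gamma n (x : 'I_n -> R) (r : R) phi0 : R :=
  inf [set (num_pieces alpha)%:R `^ (5 / 2) *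
           Num.sqrt (r ^+ 2 + ell2 x phi0 alpha)
      | alpha in pw_affine_convex].

(* With indices shifted to start at 0; the spacing condition relates each
   design point to its successor. *)
Definition design n (c1 c2 : R) (x : 'I_n -> R) : Prop :=
  [/\ forall i, 0 <= x i <= 1,
      forall i j : 'I_n, (i < j)%N -> x i < x j &
      forall i j : 'I_n, j = i.+1 :> nat ->
        c1 <= n%:R * (x j - x i) <= c2].

End ConvexRegression.

(* Main.v *)
Require Import Defs.
From HB Require Import structures.
From mathcomp Require Import all_boot all_order all_algebra.
From mathcomp Require Import all_classical all_reals all_analysis.
From mathcomp Require Import ring lra zify.
Import Order.TTheory GRing.Theory Num.Theory.
Import numFieldNormedType.Exports.
Local Open Scope classical_set_scope.
Local Open Scope ring_scope.

Set Implicit Arguments.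
Unset Strict Implicit.
Unset Printing Implicit Defensive.

(** Entropy is bounded by coding: if each function of a class receives one of
    at most [exp h] codes, and functions with the same code are [eps]-close,
    then one representative per code gives a cover, so the log covering number
    is at most [h]. Independent codes multiply, so their entropies add.

    The core estimate ([entropy_lip_convex]) is that convex functions on [0,1]
    with values and Lipschitz constant of order [D] have sup-norm entropy
    [O(sqrt (D / e))]. The code consists of the rounded Faber-Schauder
    coefficients, that is, the gaps between midpoint values and chord
    midpoints on dyadic intervals. Convexity makes these coefficients
    nonnegative, and their sum at level [l] telescopes to at most [D / 2^l].
    A vector of [m] natural numbers of sum at most [S] has
    ['C(m + S, m)] possible values. With a rounding step decaying
    geometrically on both sides of the critical level [l0], where
    [4^l0 ~ D / e], the errors sum to [O(e)] and the entropies, which also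
    decay geometrically away from [l0], sum to
    [O(2^l0) = O(sqrt (D / e))], without any logarithm.

    To reduce the theorem to this estimate, fix a piecewise affine [alpha]
    with [k] pieces. A function [phi] of the ball satisfies
    [ell2 phi alpha <= 2 (r^2 + ell2 phi0 alpha) =: R^2]. The design points
    of each piece are cut into blocks of consecutive points, each either a
    single point or a run of [p] points whose distance to the ends of its
    piece is at least [3 p] points ([whitney]). The blocks grow geometrically
    away from the ends of the piece, so that their total number is at most
    [K = k * O(1 + log n)]. On the surroundings of a block [phi - alpha] agrees
    with a convex function, and four windows of [p] points, two on
    each side, each contain a point where it is at most
    [B = sqrt (n R^2 / p)] in absolute value. Slopes of convex functions being
    monotone, this controls the function and its slopes on the block
    ([lip_convex_rescale]): after rescaling, [D] is of order [B], with a
    constant depending only on [c1 / c2].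

    Each block receives the share [n eps^2 / K] of the squared error, which
    allows a pointwise error [e = sqrt (n eps^2 / (K p))]. The length [p]
    cancels in [D / e ~ R sqrt K / eps], so all blocks cost the same and the
    total entropy is [O(K sqrt (R sqrt K / eps)) = O(K^(5/4) sqrt (R / eps))],
    which is the claim for [alpha]; the infimum over [alpha] is taken last. *)

(** * Entropy by coding *)

Section Coding.
Variable R : realType.

(** Closeness is an arbitrary relation [E] and not a ball of a metric, so that
    conditions at different places (coefficients, levels, blocks) can be coded
    separately and combined; [h] bounds the log of the number of codes. *)
Definition coded (X : Type) (F : set X) (E : X -> X -> Prop) (h : R) : Prop :=
  exists (M : nat) (code : X -> nat),
    [/\ M%:R <= expR h, forall f, F f -> (code f < M)%N &
        forall f g, F f -> F g -> code f = code g -> E f g].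

Lemma coded_weaken X (F F' : set X) (E E' : X -> X -> Prop) (h h' : R) :
  coded F E h -> F' `<=` F -> h <= h' ->
  (forall f g, F' f -> F' g -> E f g -> E' f g) -> coded F' E' h'.
Proof.
move=> [M [code [Mh codeM codeE]]] sF hh EE; exists M, code; split.
- by apply: le_trans Mh _; rewrite ler_expR.
- by move=> f /sF; exact: codeM.
- by move=> f g Ff Fg fg; apply: EE => //; apply: codeE => //; exact: sF.
Qed.

Lemma coded_preimage X Y (F : set X) (G : set Y) (T : X -> Y) E (h : R) :
  coded G E h -> (forall f, F f -> G (T f)) ->
  coded F (fun f g => E (T f) (T g)) h.
Proof.
move=> [M [code [Mh codeM codeE]]] FG; exists M, (code \o T); split => //.
- by move=> f /FG; exact: codeM.
- by move=> f g /FG Ff /FG Fg; exact: codeE.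
Qed.

(** The pair of codes is stored as the number [c1 * M2 + c2] in base [M2]. *)
Lemma coded_and X (F : set X) (E1 E2 : X -> X -> Prop) (h1 h2 : R) :
  coded F E1 h1 -> coded F E2 h2 ->
  coded F (fun f g => E1 f g /\ E2 f g) (h1 + h2).
Proof.
move=> [M1 [c1 [Mh1 cM1 cE1]]] [M2 [c2 [Mh2 cM2 cE2]]].
exists (M1 * M2)%N, (fun f => c1 f * M2 + c2 f)%N; split.
- by rewrite natrM expRD ler_pM.
- move=> f Ff; have := cM1 _ Ff; have := cM2 _ Ff => lt2 lt1.
  apply: (@leq_trans ((c1 f).+1 * M2)); last by rewrite leq_mul2r lt1 orbT.
  by rewrite mulSn addnC ltn_add2r.
- move=> f g Ff Fg eq_c.
  have f2 := cM2 _ Ff; have g2 := cM2 _ Fg.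
  have M2_gt0 : (0 < M2)%N by exact: leq_ltn_trans f2.
  split; [apply: cE1 | apply: cE2] => //.
    by have := congr1 (divn^~ M2) eq_c; rewrite !divnMDl // !divn_small // !addn0.
  by have := congr1 (modn^~ M2) eq_c; rewrite !modnMDl !modn_small.
Qed.

Lemma coded_all X (F : set X) (k : nat) (E : nat -> X -> X -> Prop)
    (h : nat -> R) :
  (forall i, (i < k)%N -> coded F (E i) (h i)) ->
  coded F (fun f g => forall i, (i < k)%N -> E i f g) (\sum_(i < k) h i).
Proof.
elim: k => [_|k IHk cE].
  by exists 1%N, (fun=> 0%N); split => //; rewrite big_ord0 expR0.
rewrite big_ord_recr /=.
have c1 : coded F (fun f g => forall i, (i < k)%N -> E i f g) (\sum_(i < k) h i).
  by apply: IHk => i ik; apply: cE; rewrite ltnS ltnW.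
apply: coded_weaken (coded_and c1 (cE k (ltnSn k))) _ _ _ => //.
move=> f g _ _ [Ek Ekk] i; rewrite ltnS leq_eqVlt => /predU1P[->//|]; exact: Ek.
Qed.

(** Rounding to multiples of [e] takes at most [1 + D / e] values, and
    [1 + u <= (1 + sqrt u)^2 <= exp (2 sqrt u)] gives this logarithmic count
    the square root form of all other entropies here. *)
Lemma coded_range X (F : set X) (T : X -> R) (lo D e : R) : 0 < e -> 0 <= D ->
  (forall f, F f -> lo <= T f <= lo + D) ->
  coded F (fun f g => `|T f - T g| <= e) (2 * Num.sqrt (D / e)).
Proof.
move=> e0 D0 FT; pose q f := (T f - lo) / e.
have q0 f : F f -> 0 <= q f.
  by move=> /FT /andP[? ?]; rewrite /q divr_ge0 ?subr_ge0 // ltW.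
have De0 : 0 <= D / e by rewrite divr_ge0 // ltW.
exists (Num.truncn (D / e)).+1, (Num.truncn \o q); split.
- rewrite -natr1; have := truncn_le (D / e); rewrite De0 => tD.
  have s0 : 0 <= Num.sqrt (D / e) by rewrite sqrtr_ge0.
  apply: (@le_trans _ _ ((1 + Num.sqrt (D / e)) ^+ 2)).
    rewrite sqrrD expr1n mul1r sqr_sqrtr //.
    by apply: (le_trans (lerD tD (lexx 1))); rewrite addrC lerD2r lerDl mulrn_wge0.
  rewrite expRM_natl lerXn2r ?nnegrE ?expR_ge0 ?addr_ge0 //.
  exact: expR_ge1Dx.
- move=> f Ff /=; rewrite ltnS; apply: le_truncn.
  by rewrite /q ler_pM2r ?invr_gt0 // lerBlDl; case/andP: (FT _ Ff).
- move=> f g Ff Fg /= tfg.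
  have /andP[lf uf] := truncn_itv (q0 _ Ff).
  have /andP[lg ug] := truncn_itv (q0 _ Fg).
  have -> : T f - T g = (q f - q g) * e.
    by rewrite /q -mulrBl divfK ?gt_eqF //; lra.
  rewrite normrM (gtr0_norm e0) -[leRHS]mul1r ler_pM2r //.
  move: lf uf ug; rewrite /= in tfg; rewrite tfg -natr1 => lf uf ug.
  by rewrite ler_norml; apply/andP; split; lra.
Qed.

(** ['C(m + s, m) z^s (1 - z)^m] is one term of the binomial expansion of
    [(z + (1 - z))^(m + s) = 1]. The free parameter [z] is tuned according to
    whether the vector is short and large or long and sparse. *)
Lemma binomial_entropy (m s : nat) (z S h : R) : 0 < z < 1 -> s%:R <= S ->
  - (S * ln z) - m%:R * ln (1 - z) <= h -> 'C(m + s, m)%:R <= expR h.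
Proof.
move=> /andP[z0 z1] sS hle.
have z1' : 0 < 1 - z by rewrite subr_gt0.
have P : 'C(m + s, m)%:R * (z ^+ s * (1 - z) ^+ m) <= 1.
  rewrite [leRHS](_ : 1 = (z + (1 - z)) ^+ (m + s)); last by rewrite subrKC expr1n.
  have mlt : (m < (m + s).+1)%N by rewrite ltnS leq_addr.
  rewrite [leRHS]exprDn (bigD1 (Ordinal mlt)) //= addKn mulr_natl lerDl sumr_ge0 //.
  by move=> i _; rewrite mulrn_wge0 // mulr_ge0 // exprn_ge0 // ltW.
have E : z ^+ s * (1 - z) ^+ m = expR (s%:R * ln z + m%:R * ln (1 - z)).
  by rewrite expRD !expRM_natl !lnK ?posrE.
rewrite E in P.
have -> : 'C(m + s, m)%:R =
    'C(m + s, m)%:R * expR (s%:R * ln z + m%:R * ln (1 - z))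
    * expR (- (s%:R * ln z + m%:R * ln (1 - z))) :> R.
  by rewrite -mulrA -expRD subrr expR0 mulr1.
apply: le_trans (ler_wpM2r (expR_ge0 _) P) _.
rewrite mul1r ler_expR; apply: le_trans hle.
have : S * ln z <= s%:R * ln z by rewrite ler_wnM2r // ln_le0 // ltW.
lra.
Qed.

(** Rounding down keeps the sum of the rounded entries at most [S], and the
    vectors of [m] natural numbers with sum at most [s] are counted by
    ['C(m + s, m)]. *)
Lemma coded_vector X (F : set X) (m : nat) (T : X -> nat -> R) (d S z h : R) :
  0 < d -> 0 < z < 1 -> 0 <= S ->
  (forall f i, F f -> (i < m)%N -> 0 <= T f i) ->
  (forall f, F f -> \sum_(i < m) T f i <= S * d) ->
  - (S * ln z) - m%:R * ln (1 - z) <= h ->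
  coded F (fun f g => forall i, (i < m)%N -> `|T f i - T g i| <= d) h.
Proof.
move=> d0 z01 S0 T0 TS hh; pose s := Num.truncn S.
pose v f (i : nat) := Num.truncn (T f i / d).
pose A := [set t : m.-tuple 'I_s.+1 | (\sum_(i <- t) i <= s)%N]%SET.
pose w f : m.-tuple 'I_s.+1 := [tuple inord (v f i) | i < m].
have v_le f i : F f -> (i < m)%N -> (v f i)%:R <= T f i / d.
  by move=> Ff im; rewrite /v truncn_le divr_ge0 ?T0 // ltW.
have sumv f : F f -> (\sum_(i < m) v f i <= s)%N.
  move=> Ff; rewrite /s truncn_ge_nat // natr_sum.
  apply: (@le_trans _ _ (\sum_(i < m) T f i / d)).
    by apply: ler_sum => i _; exact: v_le.
  by rewrite -mulr_suml ler_pdivrMr // TS.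
have v_small f i : F f -> (i < m)%N -> (v f i < s.+1)%N.
  move=> Ff im; rewrite ltnS; apply: leq_trans (sumv f Ff).
  by rewrite (bigD1 (Ordinal im)) //= leq_addr.
have wA f : F f -> w f \in A.
  move=> Ff; rewrite inE big_tuple; apply: leq_trans (sumv f Ff).
  by apply: leq_sum => i _; rewrite tnth_mktuple inordK // v_small.
exists #|A|, (fun f => index (w f) (enum A)); split.
- rewrite card_partial_ord_partitions; apply: binomial_entropy z01 _ hh.
  by rewrite /s truncn_le.
- by move=> f Ff; rewrite cardE index_mem mem_enum wA.
- move=> f g Ff Fg eqi i im.
  have wfg : w f = w g.
    rewrite -[w f](@nth_index _ (w f) _ (enum A)) ?mem_enum ?wA // eqi.
    by rewrite nth_index // mem_enum wA.
  have vfg : v f i = v g i.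
    have := congr1 (fun t => val (tnth t (Ordinal im))) wfg.
    by rewrite /= !tnth_mktuple !inordK // v_small.
  have Tf0 : 0 <= T f i / d by rewrite divr_ge0 ?T0 // ltW.
  have Tg0 : 0 <= T g i / d by rewrite divr_ge0 ?T0 // ltW.
  have /andP[lf uf] := truncn_itv Tf0.
  have /andP[lg ug] := truncn_itv Tg0.
  have -> : T f i - T g i = (T f i / d - T g i / d) * d.
    by rewrite -mulrBl divfK ?gt_eqF.
  rewrite normrM (gtr0_norm d0) -[leRHS]mul1r ler_pM2r //.
  move: lf uf; rewrite -/(v f i) vfg -natr1 => lf uf.
  by move: ug; rewrite -/(v g i) -natr1 => ug; rewrite ler_norml; apply/andP; split; lra.
Qed.

(** A center is chosen among the members of [F] that share a given code. *)
Lemma covered_by_coded (X : Type) (F : set X) (rho : X -> X -> R) (e h : R) :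
  F !=set0 -> coded F (fun f g => rho f g <= e) h ->
  exists2 N, Defs.covered_by rho e F N & N%:R <= expR h.
Proof.
move=> [f0 F0] [N [code [Nh codeN codeE]]]; exists N => //.
have rep (i : 'I_N) : exists g, (exists2 f, F f & code f = i) -> F g /\ code g = i.
  have [[f Ff fi]|nf] := pselect (exists2 f, F f & code f = i); first by exists f.
  by exists f0.
have [c cP] := choice rep.
exists c => f Ff; exists (Ordinal (codeN _ Ff)) => //=.
have [Fc cc] := cP (Ordinal (codeN _ Ff)) (ex_intro2 _ _ f Ff erefl).
exact: codeE.
Qed.

End Coding.

(** * Bounded Lipschitz convex functions *)

Section LipschitzConvex.
Variable R : realType.
Implicit Types (g : R -> R) (D e A : R).

(** Powers of [1/2] as parameter [z] of [binomial_entropy] make both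
    logarithms easy to bound: [ln 2 <= 1], and
    [- ln (1 - y) = ln (1 + y / (1 - y)) <= 2 y] for [0 <= y <= 1/2]. *)
Lemma ln_dyadic (k : nat) (y : R) : y = 2^-1 ^+ k.+1 ->
  [/\ 0 < y < 1, - ln y <= k%:R + 1 & - ln (1 - y) <= 2^-1 ^+ k].
Proof.
move=> ->; have p0 : 0 < 2^-1 ^+ k :> R by rewrite exprn_gt0 // invr_gt0.
have p1 : 2^-1 ^+ k <= 1 :> R by rewrite exprn_ile1 ?invr_ge0 // invf_le1 // ler1n.
have ln2 : ln (2 : R) <= 1.
  by have := @le_ln1Dx R 1; rewrite -[1 + 1]/(2 : R); apply; lra.
have ln2_ge0 : 0 <= ln (2 : R) by rewrite ln_ge0 // ler1n.
have y12 : 2^-1 ^+ k.+1 <= 2^-1 :> R by rewrite exprS ler_piMr // invr_ge0.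
have y0 : 0 < 2^-1 ^+ k.+1 :> R by rewrite exprn_gt0 // invr_gt0.
have yE : 2^-1 ^+ k.+1 * 2 = 2^-1 ^+ k :> R by rewrite exprS mulrAC mulVf ?mul1r // pnatr_eq0.
split.
- by rewrite y0 /=; lra.
- rewrite lnXn ?invr_gt0 // lnV ?posrE // mulNrn opprK natr1 -[leRHS]mul1r.
  by rewrite -[leLHS]mulr_natr ler_wpM2r.
- have d0 : 0 < 1 - 2^-1 ^+ k.+1 :> R by lra.
  rewrite -lnV ?posrE //.
  have -> : (1 - 2^-1 ^+ k.+1)^-1 = 1 + 2^-1 ^+ k.+1 / (1 - 2^-1 ^+ k.+1) :> R.
    by field; rewrite gt_eqF.
  apply: (le_trans (le_ln1Dx _)).
    by apply: lt_le_trans (_ : 0 <= _); rewrite ?oppr_lt0 // divr_ge0 // ltW.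
  rewrite ler_pdivrMr // -yE; move: y0 y12; set w := 2^-1 ^+ k.+1 => w0 w12; nra.
Qed.

(** At [j] levels beyond the critical one there are [A 2^j] coefficients
    whose rounded sum is at most [A (2/3)^j]: a sparse vector, for which
    [z ~ 4^-j] is a good choice. *)
Lemma fine_level_entropy A (j : nat) : 0 <= A ->
  forall z, z = 2^-1 ^+ (2 * j).+1 ->
  - (A * (2 / 3) ^+ j * ln z) - A * 2 ^+ j * ln (1 - z) <=
  A * ((2 / 3) ^+ j * (3 * j%:R + 2)).
Proof.
move=> A0 z zE; have [z01 lz l1z] := ln_dyadic zE.
have q0 : 0 <= (2 / 3) ^+ j :> R by rewrite exprn_ge0 // divr_ge0.
have p0 : 0 <= 2 ^+ j :> R by rewrite exprn_ge0.
have E1 : (2 / 3) ^+ j * - ln z <= (2 / 3) ^+ j * ((2 * j)%:R + 1) by rewrite ler_wpM2l.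
have E2 : 2 ^+ j * - ln (1 - z) <= (2 / 3) ^+ j.
  apply: (@le_trans _ _ (2 ^+ j * 2^-1 ^+ (2 * j))); first by rewrite ler_wpM2l.
  rewrite exprM -exprMn lerXn2r ?nnegrE ?divr_ge0 ?mulr_ge0 ?exprn_ge0 ?invr_ge0 //.
  by lra.
have -> : - (A * (2 / 3) ^+ j * ln z) - A * 2 ^+ j * ln (1 - z) =
  A * ((2 / 3) ^+ j * - ln z + 2 ^+ j * - ln (1 - z)) by ring.
rewrite ler_wpM2l //; apply: le_trans (lerD E1 E2) _.
have j0 : 0 <= j%:R :> R by rewrite ler0n.
rewrite natrM -[X in _ + X <= _]mulr1 -mulrDr ler_wpM2l //; lra.
Qed.

(** At [j] levels before the critical one there are only [A / 2^j]
    coefficients, whose rounded sum is at most [A (8/3)^j]: a short vector with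
    large entries, for which [1 - z ~ 8^-j] is a good choice. The bound is the
    one of [fine_level_entropy], so that both sides sum alike. *)
Lemma coarse_level_entropy A (j : nat) : 0 <= A ->
  forall z, z = 1 - 2^-1 ^+ (3 * j).+1 ->
  - (A * (8 / 3) ^+ j * ln z) - A / 2 ^+ j * ln (1 - z) <=
  A * ((2 / 3) ^+ j * (3 * j%:R + 2)).
Proof.
move=> A0 z zE; have [y01 ly] := @ln_dyadic (3 * j) (1 - z) ltac:(by rewrite zE subKr).
rewrite subKr => l1y.
have q0 : 0 <= (8 / 3) ^+ j :> R by rewrite exprn_ge0 // divr_ge0.
have p0 : 0 <= 2^-1 ^+ j :> R by rewrite exprn_ge0 // invr_ge0.
have p23 : 2^-1 ^+ j <= (2 / 3) ^+ j :> R.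
  by rewrite lerXn2r ?nnegrE ?divr_ge0 ?invr_ge0 //; lra.
have E1 : 2^-1 ^+ j * - ln (1 - z) <= (2 / 3) ^+ j * ((3 * j)%:R + 1).
  apply: (@le_trans _ _ (2^-1 ^+ j * ((3 * j)%:R + 1))); first by rewrite ler_wpM2l.
  by rewrite ler_wpM2r // addr_ge0.
have E2 : (8 / 3) ^+ j * - ln z <= (2 / 3) ^+ j.
  apply: (@le_trans _ _ ((8 / 3) ^+ j * 2^-1 ^+ (3 * j))); first by rewrite ler_wpM2l.
  rewrite exprM -exprMn lerXn2r ?nnegrE ?divr_ge0 ?mulr_ge0 ?exprn_ge0 ?invr_ge0 //.
  by lra.
rewrite -exprVn.
have -> : - (A * (8 / 3) ^+ j * ln z) - A * 2^-1 ^+ j * ln (1 - z) =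
  A * ((8 / 3) ^+ j * - ln z + 2^-1 ^+ j * - ln (1 - z)) by ring.
rewrite ler_wpM2l //; apply: le_trans (lerD E2 E1) _.
by rewrite natrM le_eqVlt; apply/orP; left; apply/eqP; ring.
Qed.

(** The distance between two levels; one of the truncated differences is 0. *)
Definition level_gap (l0 l : nat) : nat := ((l - l0) + (l0 - l))%N.

(** Each distance to [l0] is realized by at most one level on either side. *)
Lemma sum_level_gap (l0 : nat) (F : nat -> R) : (forall j, 0 <= F j) ->
  \sum_(l < l0 + l0) F (level_gap l0 l) <= 2 * \sum_(j < l0.+1) F j.
Proof.
move=> F0; rewrite big_split_ord /= (reindex_inj rev_ord_inj) /=.
have -> : \sum_(j < l0) F (level_gap l0 (l0 - j.+1)) = \sum_(j < l0) F j.+1.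
  by apply: eq_bigr => j _; congr F; rewrite /level_gap; have := ltn_ord j; lia.
have -> : \sum_(j < l0) F (level_gap l0 (l0 + j)) = \sum_(j < l0) F j.
  by apply: eq_bigr => j _; congr F; rewrite /level_gap; lia.
have := F0 0%N; have := F0 l0.
have : \sum_(j < l0.+1) F j = F 0%N + \sum_(j < l0) F j.+1 by rewrite big_ord_recl.
have : \sum_(j < l0.+1) F j = \sum_(j < l0) F j + F l0 by rewrite big_ord_recr.
lra.
Qed.

Lemma sum_geometric_34 (n : nat) : \sum_(j < n) (3 / 4) ^+ j <= 4 :> R.
Proof.
have -> : \sum_(j < n) (3 / 4) ^+ j = 4 - 4 * (3 / 4) ^+ n :> R.
  by elim: n => [|n IH]; rewrite ?big_ord0 ?big_ord_recr /= ?IH ?exprS; lra.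
by rewrite gerBl mulr_ge0 // exprn_ge0 // divr_ge0.
Qed.

Lemma sum_level_entropy (n : nat) :
  \sum_(j < n) (2 / 3) ^+ j * (3 * j%:R + 2) <= 24 :> R.
Proof.
have -> : \sum_(j < n) (2 / 3) ^+ j * (3 * j%:R + 2) =
    24 - (9 * n%:R + 24) * (2 / 3) ^+ n :> R.
  elim: n => [|n IH]; first by rewrite big_ord0 expr0; lra.
  rewrite big_ord_recr /= IH exprS -[n.+1%:R]natr1; set p := (2 / 3) ^+ n; lra.
by rewrite gerBl mulr_ge0 ?exprn_ge0 ?divr_ge0 // addr_ge0 // mulr_ge0.
Qed.

(** Midpoint convexity is the form in which convexity enters the
    Faber-Schauder coefficients. *)
Definition lip_convex D : set (R -> R) :=
  [set g | [/\ `|g 0| <= D,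
     forall s t : R, 0 <= s <= 1 -> 0 <= t <= 1 -> `|g s - g t| <= D * `|s - t| &
     forall s t : R, 0 <= s <= 1 -> 0 <= t <= 1 ->
       g ((s + t) / 2) *+ 2 <= g s + g t]].

Definition dyadic (l i : nat) : R := i%:R / 2 ^+ l.

(** The coefficient of [g] on the hat function of the [i]-th dyadic interval of
    level [l], with the sign that makes it nonnegative for convex [g]. *)
Definition schauder g (l i : nat) : R :=
  (g (dyadic l i) + g (dyadic l i.+1)) / 2 - g (dyadic l.+1 (2 * i).+1).

Lemma dyadic_itv l i : (i <= 2 ^ l)%N -> 0 <= dyadic l i <= 1.
Proof.
move=> il; rewrite divr_ge0 ?exprn_ge0 //= ler_pdivrMr ?exprn_gt0 // mul1r.
by rewrite -natrX ler_nat.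
Qed.

Lemma dyadic_even l i : dyadic l.+1 (2 * i) = dyadic l i.
Proof.
have : (2 : R) ^+ l != 0 by rewrite expf_neq0 // pnatr_eq0.
by rewrite /dyadic natrM exprS => ?; field.
Qed.

Lemma dyadic_mid l i : (dyadic l i + dyadic l i.+2) / 2 = dyadic l i.+1.
Proof.
rewrite /dyadic -[i.+2%:R]natr1 -[i.+1%:R]natr1; field.
by rewrite expf_neq0 // pnatr_eq0.
Qed.

Lemma schauder_ge0 D g l i : lip_convex D g -> (i < 2 ^ l)%N ->
  0 <= schauder g l i.
Proof.
move=> [_ _ cg] il.
have i1 : (i <= 2 ^ l)%N by exact: ltnW.
have := cg _ _ (dyadic_itv i1) (dyadic_itv il).
rewrite -(dyadic_even l i) -(dyadic_even l i.+1) mulnS add2n dyadic_mid.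
by rewrite /schauder -(dyadic_even l i) -(dyadic_even l i.+1) mulnS add2n; lra.
Qed.

(** Twice a coefficient is the difference of the increments of [g] over the two
    halves of the interval. For convex [g] the increments [E] increase, so the
    sum of these differences is at most the last increment minus the first
    one, and each is at most [D / 2^(l + 1)] in absolute value. *)
Lemma sum_schauder D g l : lip_convex D g ->
  \sum_(i < 2 ^ l) schauder g l i <= D / 2 ^+ l.
Proof.
move=> [_ lg cg].
pose E j := g (dyadic l.+1 j.+1) - g (dyadic l.+1 j).
have mE j : (j.+2 <= 2 ^ l.+1)%N -> E j <= E j.+1.
  move=> jl; have j0 : (j <= 2 ^ l.+1)%N by lia.
  have := cg _ _ (dyadic_itv j0) (dyadic_itv jl).
  by rewrite dyadic_mid /E; lra.
have sE i : schauder g l i *+ 2 = E (2 * i).+1 - E (2 * i)%N.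
  rewrite /schauder -(dyadic_even l i) -(dyadic_even l i.+1) mulnS add2n /E.
  by lra.
have D0 : 0 <= D.
  by have := lg 0 1; rewrite sub0r normrN1 mulr1 => h; apply: le_trans (h _ _) => //; lra.
have bE j : (j < 2 ^ l.+1)%N -> `|E j| <= D / 2 ^+ l.+1.
  move=> jl; rewrite /E; apply: le_trans (lg _ _ _ _) _.
  - by apply: dyadic_itv.
  - by apply: dyadic_itv; exact: ltnW.
  rewrite ler_wpM2l // /dyadic -mulrBl -natrB // subSnn mul1r ger0_norm //.
have S k : (k < 2 ^ l)%N -> (\sum_(i < k.+1) schauder g l i) *+ 2 <= E (2 * k).+1 - E 0%N.
  elim: k => [|k IH] kl; first by rewrite big_ord1 sE.
  rewrite big_ord_recr /= mulrnDl sE.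
  have := IH (ltnW kl).
  have := mE (2 * k).+1; rewrite mulnS add2n => h.
  have : E (2 * k).+1 <= E (2 * k).+2 by apply: h; rewrite expnS; lia.
  lra.
have l1 : (0 < 2 ^ l)%N by rewrite expn_gt0.
have := S (2 ^ l).-1; rewrite prednK // => /(_ (leqnn _)) h.
have a1 : `|E (2 * (2 ^ l).-1).+1| <= D / 2 ^+ l.+1 by apply: bE; rewrite expnS; lia.
have a2 : `|E 0%N| <= D / 2 ^+ l.+1 by apply: bE; rewrite expn_gt0.
have b1 := le_trans (ler_norm _) a1.
have b2 : - E 0%N <= D / 2 ^+ l.+1 by apply: le_trans a2; rewrite -normrN ler_norm.
have : D / 2 ^+ l.+1 * 2 = D / 2 ^+ l.
  by rewrite exprS; field; rewrite expf_neq0 // pnatr_eq0.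
have := le_trans (normr_ge0 _) a2; lra.
Qed.

(** The rounding step [e (3/4)^j], with [j] the distance to the critical level
    [l0], is summable over levels, yet decays slowly enough that the number of
    codes decays too: any ratio strictly between 1/2 and 1 would do. *)
Lemma coded_schauder D e (l0 l : nat) : 0 < e -> 0 <= D -> D <= 4 ^+ l0 * e ->
  coded (lip_convex D)
    (fun f g => forall i, (i < 2 ^ l)%N ->
       `|schauder f l i - schauder g l i| <= e * (3 / 4) ^+ level_gap l0 l)
    (2 ^+ l0 * ((2 / 3) ^+ level_gap l0 l * (3 * (level_gap l0 l)%:R + 2)) : R).
Proof.
move=> e0 D0 De; set j := level_gap l0 l.
have A0 : 0 <= 2 ^+ l0 :> R by rewrite exprn_ge0.
have w0 : 0 < e * (3 / 4) ^+ j by rewrite mulr_gt0 // exprn_gt0 // divr_gt0.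
have pow4 : 4 ^+ l0 = 2 ^+ l0 * 2 ^+ l0 :> R by rewrite -exprMn; congr (_ ^+ _); ring.
have n0 k : 2 ^+ k != 0 :> R by rewrite expf_neq0 // pnatr_eq0.
have [ll|ll] := leqP l0 l.
- have lE : l = (l0 + j)%N by rewrite /j /level_gap; lia.
  have [z01 _ _] := @ln_dyadic (2 * j) _ erefl.
  apply: (coded_vector (T := fun g => schauder g l) (S := 2 ^+ l0 * (2 / 3) ^+ j) w0 z01).
  + by rewrite mulr_ge0 // exprn_ge0 // divr_ge0.
  + by move=> f i Ff; exact: schauder_ge0 Ff.
  + move=> f /(@sum_schauder _ _ l) h; apply: (le_trans h).
    rewrite ler_pdivrMr ?exprn_gt0 // (le_trans De) //.
    have -> : 2 ^+ l0 * (2 / 3) ^+ j * (e * (3 / 4) ^+ j) * 2 ^+ l =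
       e * (2 ^+ l0 * 2 ^+ l0) * ((2 / 3) * (3 / 4) * 2) ^+ j :> R.
      by rewrite lE exprD !exprMn; ring.
    have -> : (2 / 3) * (3 / 4) * 2 = 1 :> R by lra.
    by rewrite expr1n mulr1 pow4 mulrC.
  + by rewrite natrX lE exprD; exact: (fine_level_entropy A0 erefl).
- have lE : l0 = (l + j)%N by rewrite /j /level_gap; lia.
  have [/andP[y0 y1] _ _] := @ln_dyadic (3 * j) _ erefl.
  have z01 : 0 < (1 - 2^-1 ^+ (3 * j).+1 : R) < 1.
    by rewrite subr_gt0 y1 ltrBlDr ltrDl.
  apply: (coded_vector (T := fun g => schauder g l) (S := 2 ^+ l0 * (8 / 3) ^+ j) w0 z01).
  + by rewrite mulr_ge0 // exprn_ge0 // divr_ge0.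
  + by move=> f i Ff; exact: schauder_ge0 Ff.
  + move=> f /(@sum_schauder _ _ l) h; apply: (le_trans h).
    rewrite ler_pdivrMr ?exprn_gt0 // (le_trans De) //.
    have -> : 4 ^+ l0 * e = e * (2 ^+ l0 * 2 ^+ l) * ((8 / 3) * (3 / 4)) ^+ j.
      have -> : (8 / 3) * (3 / 4) = 2 :> R by lra.
      by rewrite pow4 lE exprD; ring.
    by rewrite le_eqVlt; apply/orP; left; apply/eqP; rewrite !exprMn; ring.
  + have -> : (2 ^ l)%:R = 2 ^+ l0 / 2 ^+ j :> R.
      by rewrite natrX lE exprD mulfK.
    exact: (coarse_level_entropy A0 erefl).
Qed.

(** The minimal admissible [l0] satisfies [4^(l0 - 1) < D / e] unless it is 0. *)
Lemma dyadic_scale D e : 0 < e -> e <= D ->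
  exists2 l0 : nat, D <= 4 ^+ l0 * e & 2 ^+ l0 <= 2 * Num.sqrt (D / e).
Proof.
move=> e0 eD; have De1 : 1 <= D / e by rewrite ler_pdivlMr // mul1r.
have De0 : 0 <= D / e by apply: le_trans De1.
have ex : exists l, D / e <= 4 ^+ l.
  exists (Num.truncn (D / e)).+1; apply: ltW; apply: lt_le_trans (truncnS_gt _) _.
  by rewrite -natrX ler_nat ltnW // ltn_expl.
have [l0 Pl0 min_l0] := ex_minnP ex; exists l0; first by rewrite -ler_pdivrMr.
case: l0 Pl0 min_l0 => [|l] _ min_l0.
  have s1 : 1 <= Num.sqrt (D / e) by rewrite -sqrtr1 ler_wsqrtr.
  by rewrite expr0; lra.
rewrite exprS ler_pM2l // -(ger0_norm (exprn_ge0 l (ler0n _ 2))) -sqrtr_sqr ler_wsqrtr //.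
rewrite -exprM mulnC exprM -natrX; apply: ltW; rewrite ltNge; apply/negP.
by move=> /min_l0; rewrite ltnn.
Qed.

(** Levels below [2 * l0] suffice: at that resolution the Lipschitz bound makes
    the variation between neighboring dyadic points at most [D / 4^l0 <= e].
    The two end values and the coefficients determine the values at all dyadic
    points, each level adding its rounding step to the error. *)
Lemma entropy_lip_convex D e : 0 < e -> e <= D ->
  coded (lip_convex D)
    (fun f g => forall t, 0 <= t <= 1 -> `|f t - g t| <= 11 * e)
    (104 * Num.sqrt (D / e)).
Proof.
move=> e0 eD; have D0 : 0 <= D by apply: le_trans eD; exact: ltW.
have [l0 Dl0 l0D] := dyadic_scale e0 eD.
have sD0 : 0 <= Num.sqrt (D / e) by exact: sqrtr_ge0.
have c0 : coded (lip_convex D) (fun f g => `|f 0 - g 0| <= e) (4 * Num.sqrt (D / e)).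
  apply: coded_weaken (coded_range (F := lip_convex D) (T := fun f => f 0)
    (lo := - D) (D := D *+ 4) e0 _ _) _ _ _ => //.
  - by rewrite mulrn_wge0.
  - by move=> f [f0 _ _]; move: f0; rewrite ler_norml => /andP[? ?]; lra.
  - have -> : D *+ 4 / e = 2 ^+ 2 * (D / e) by ring.
    by rewrite sqrtrM ?sqr_ge0 // sqrtr_sqr ger0_norm // mulrA; lra.
have c1 : coded (lip_convex D) (fun f g => `|f 1 - g 1| <= e) (4 * Num.sqrt (D / e)).
  apply: coded_weaken (coded_range (F := lip_convex D) (T := fun f => f 1)
    (lo := - (D *+ 2)) (D := D *+ 4) e0 _ _) _ _ _ => //.
  - by rewrite mulrn_wge0.
  - move=> f [f0 /(_ 1 0) f1 _]; rewrite subr0 normr1 mulr1 in f1.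
    have : `|f 1 - f 0| <= D by apply: f1; lra.
    by move: f0; rewrite !ler_norml => /andP[? ?] /andP[? ?]; lra.
  - have -> : D *+ 4 / e = 2 ^+ 2 * (D / e) by ring.
    by rewrite sqrtrM ?sqr_ge0 // sqrtr_sqr ger0_norm // mulrA; lra.
have cl := coded_all (fun l (_ : (l < l0 + l0)%N) => @coded_schauder D e l0 l e0 D0 Dl0).
apply: coded_weaken (coded_and (coded_and c0 c1) cl) _ _ _ => //.
  rewrite -mulr_sumr.
  have h := @sum_level_gap l0 (fun j => (2 / 3) ^+ j * (3 * j%:R + 2)).
  have : \sum_(l < l0 + l0)
     (2 / 3) ^+ level_gap l0 l * (3 * (level_gap l0 l)%:R + 2) <= 48 :> R.
    apply: le_trans (h _) _; last by have := sum_level_entropy l0.+1; lra.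
    by move=> j; rewrite mulr_ge0 ?exprn_ge0 ?divr_ge0 // addr_ge0 // mulr_ge0.
  set s := \sum_(l < _) _ => s48.
  have : 2 ^+ l0 * s <= 2 * Num.sqrt (D / e) * 48.
    apply: le_trans (_ : 2 ^+ l0 * 48 <= _); first by rewrite ler_wpM2l // exprn_ge0.
    by rewrite ler_wpM2r.
  lra.
move=> f g [f0 lf cf] [g0 lg cg] [[E0 E1] EL] t t01.
(* The error accumulated at the dyadic points of level [l]. *)
pose err l := e + \sum_(k < l) e * (3 / 4) ^+ level_gap l0 k.
have dyad l : (l <= l0 + l0)%N -> forall i, (i <= 2 ^ l)%N ->
    `|f (dyadic l i) - g (dyadic l i)| <= err l.
  elim: l => [|l IH] ll i il.
    rewrite /err big_ord0 addr0 /dyadic expr0 divr1.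
    by move: il; rewrite expn0; case: i => [|[|]].
  have wl0 : 0 <= e * (3 / 4) ^+ level_gap l0 l.
    by rewrite mulr_ge0 ?exprn_ge0 ?divr_ge0 // ltW.
  have errS : err l.+1 = err l + e * (3 / 4) ^+ level_gap l0 l.
    by rewrite /err big_ord_recr addrA.
  have {}IH := IH (ltnW ll).
  case: (boolP (odd i)) => oi; last first.
    have il' : (i./2 <= 2 ^ l)%N by rewrite leq_half_double -mul2n -expnS leqW.
    have -> : i = (2 * i./2)%N by rewrite mul2n even_halfK.
    by rewrite dyadic_even errS; apply: le_trans (IH _ il') _; rewrite lerDl.
  have iE : i = (2 * i./2).+1 by rewrite mul2n -{1}(odd_double_half i) oi.
  have il' : (i./2 < 2 ^ l)%N.
    by rewrite -(ltn_pmul2l (isT : (0 < 2)%N)) -expnS -iE.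
  have a1 := IH _ (ltnW il'); have a2 := IH _ il'.
  have a3 := EL l ll _ il'.
  rewrite iE errS; move: a1 a2 a3; rewrite /schauder !ler_norml.
  by move=> /andP[? ?] /andP[? ?] /andP[? ?]; apply/andP; split; lra.
pose L := (l0 + l0)%N; pose i := Num.truncn (t * 2 ^+ L).
have p0 : 0 < 2 ^+ L :> R by rewrite exprn_gt0.
case/andP: (t01) => t0 t1.
have tL0 : 0 <= t * 2 ^+ L by rewrite mulr_ge0 // ltW.
have /andP[li ui] := truncn_itv tL0; rewrite -/i -natr1 in li ui.
have iL : (i <= 2 ^ L)%N.
  by rewrite -(ler_nat R) natrX; apply: le_trans li _; rewrite ler_piMl // ltW.
have dL := dyadic_itv iL.
have near : `|t - dyadic L i| <= (2 ^+ L)^-1.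
  have -> : t - dyadic L i = (t * 2 ^+ L - i%:R) / 2 ^+ L.
    by rewrite mulrBl mulfK // gt_eqF.
  have iv0 : 0 <= (2 ^+ L)^-1 :> R by rewrite invr_ge0 ltW.
  rewrite normrM (ger0_norm iv0) ler_piMl //.
  by rewrite ler_norml; apply/andP; split; lra.
have DL : D * `|t - dyadic L i| <= e.
  apply: le_trans (ler_wpM2l D0 near) _; rewrite ler_pdivrMr // (le_trans Dl0) //.
  rewrite mulrC ler_pM2l // /L exprD -exprMn.
  by have -> : 2 * 2 = 4 :> R by ring.
have nf := le_trans (lf _ _ t01 dL) DL.
have ng := le_trans (lg _ _ t01 dL) DL.
have nd := dyad L (leqnn _) _ iL.
have errL : err L <= 9 * e.
  have s34 := @sum_level_gap l0 (fun j => (3 / 4) ^+ j).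
  rewrite /err -mulr_sumr.
  have : \sum_(k < L) (3 / 4) ^+ level_gap l0 k <= 8 :> R.
    apply: le_trans (s34 _) _; last by have := sum_geometric_34 l0.+1; lra.
    by move=> j; rewrite exprn_ge0 // divr_ge0.
  rewrite -(ler_pM2l e0); lra.
move: nf ng nd; rewrite !ler_norml => /andP[? ?] /andP[? ?] /andP[? ?].
by apply/andP; split; lra.
Qed.

End LipschitzConvex.

(** * From a few small values to a Lipschitz bound *)

Section ConvexGeometry.
Variable R : realType.
Implicit Types (f : R -> R).

Definition chord_convex f : Prop :=
  forall a b s : R, 0 <= a <= 1 -> 0 <= b <= 1 -> 0 <= s <= 1 ->
    f (s * a + (1 - s) * b) <= s * f a + (1 - s) * f b.

Lemma convex01_sub_affine f (p q : R) : convex01 f ->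
  chord_convex (fun y => f y - (p * y + q)).
Proof.
move=> cf a b s a01 b01 s01.
have := cf (@Itv01 R s (proj1 (andP s01)) (proj2 (andP s01))) a b.
rewrite !inE /= !in_itv /= => /(_ a01 b01).
rewrite !convRE /= /unstable.onem.
rewrite -[conv _ _ _]/(s * a + (1 - s) * b) => h; lra.
Qed.

Lemma chord_convex_slope f (x y z : R) : chord_convex f ->
  0 <= x -> x < y -> y < z -> z <= 1 ->
  (f y - f x) / (y - x) <= (f z - f y) / (z - y).
Proof.
move=> cf x0 xy yz z1.
have yx : 0 < y - x by rewrite subr_gt0.
have zy : 0 < z - y by rewrite subr_gt0.
have zx : 0 < z - x by lra.
(* The weight of [x] in [y] as a convex combination of [x] and [z]. *)
pose s := (z - y) / (z - x).
have s01 : 0 <= s <= 1.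
  by rewrite /s divr_ge0 ?(ltW zy) ?(ltW zx) //= ler_pdivrMr //; lra.
have := cf x z s _ _ s01.
have -> : s * x + (1 - s) * z = y by rewrite /s; field; rewrite gt_eqF.
move=> h; have {h} := h ltac:(lra) ltac:(lra).
have sE : s * (z - x) = z - y by rewrite /s divfK // gt_eqF.
move=> h; rewrite ler_pdivrMr // mulrAC ler_pdivlMr //.
have := ler_wpM2r (ltW zx) h.
have -> : (s * f x + (1 - s) * f z) * (z - x) =
  s * (z - x) * f x + ((z - x) - s * (z - x)) * f z by ring.
rewrite sE; lra.
Qed.

Lemma chord_convex_slope4 f (x y z w : R) : chord_convex f ->
  0 <= x -> x < y -> y <= z -> z < w -> w <= 1 ->
  (f y - f x) / (y - x) <= (f w - f z) / (w - z).
Proof.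
move=> cf x0 xy + zw w1; rewrite le_eqVlt => /predU1P[yz|yz].
  by rewrite -yz in zw *; exact: chord_convex_slope.
by apply: (@le_trans _ _ ((f z - f y) / (z - y))); apply: chord_convex_slope => //; lra.
Qed.

(** All slopes between [u] and [v] lie between the slope over [u', u] and the
    slope over [v, v'], which are at most [2 B / d] in absolute value. *)
Lemma chord_convex_lipschitz f (u' u v v' B d : R) : chord_convex f -> 0 < d ->
  0 <= u' -> d <= u - u' -> u <= v -> d <= v' - v -> v' <= 1 ->
  `|f u'| <= B -> `|f u| <= B -> `|f v| <= B -> `|f v'| <= B ->
  forall s t, u <= s <= v -> u <= t <= v -> `|f s - f t| <= 2 * B / d * `|s - t|.
Proof.
move=> cf d0 u0 uu uv vv v1 fu' fu fv fv'.
have B0 : 0 <= B by apply: le_trans fu.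
suff W s t : u <= s -> s < t -> t <= v -> `|f t - f s| <= 2 * B / d * (t - s).
  move=> s t /andP[us sv] /andP[ut tv].
  have [st|ts|->] := ltgtP s t.
  - by rewrite distrC [`|s - t|]distrC [`|t - s|]gtr0_norm ?subr_gt0 // W.
  - by rewrite [`|s - t|]gtr0_norm ?subr_gt0 // W.
  - by rewrite !subrr !normr0 mulr0.
move=> us st tv.
have ts : 0 < t - s by rewrite subr_gt0.
have bnd a b c : d <= c -> `|a| <= B -> `|b| <= B -> `|(a - b) / c| <= 2 * B / d.
  move=> dc aB bB; have c0 : 0 < c by apply: lt_le_trans dc.
  rewrite normrM [X in _ * X]gtr0_norm ?invr_gt0 //.
  apply: ler_pM => //; last by rewrite lef_pV2.
  - by rewrite invr_ge0 ltW.
  - by apply: le_trans (ler_normB _ _) _; lra.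
have L := chord_convex_slope4 cf u0 (ltac:(lra) : u' < u) us st (ltac:(lra) : t <= 1).
have U := chord_convex_slope4 cf (ltac:(lra) : 0 <= s) st tv (ltac:(lra) : v < v') v1.
have bL := bnd (f u) (f u') _ uu fu fu'.
have bU := bnd (f v') (f v) _ vv fv' fv.
move: bL bU; rewrite !ler_norml => /andP[bL _] /andP[_ bU].
have {}L := le_trans bL L; have {}U := le_trans U bU.
rewrite ler_pdivlMr // in L; rewrite ler_pdivrMr // in U.
by rewrite mulNr in L; rewrite L U.
Qed.

(** The points [u', u, v, v'] may depend on [f], while [lo] and [hi] may not:
    the latter fix the parametrization used for coding a whole class. *)
Lemma lip_convex_rescale f (u' u v v' lo hi B d rho : R) : chord_convex f ->
  0 < d -> 0 <= u' -> d <= u - u' -> u <= lo -> lo < hi -> hi <= v ->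
  d <= v' - v -> v' <= 1 -> v - u <= rho * d ->
  `|f u'| <= B -> `|f u| <= B -> `|f v| <= B -> `|f v'| <= B ->
  lip_convex (B * (1 + 2 * rho)) (fun t => f (lo + t * (hi - lo))).
Proof.
move=> cf d0 u0 uu ulo lohi hiv vv v1 vurho fu' fu fv fv'.
have B0 : 0 <= B by apply: le_trans fu.
have uv : u <= v by lra.
have L := chord_convex_lipschitz cf d0 u0 uu uv vv v1 fu' fu fv fv'.
have lip a : 0 <= a -> a <= v - u -> 2 * B / d * a <= 2 * B * rho.
  move=> a0 avu; rewrite -mulrA ler_wpM2l ?mulr_ge0 //.
  by rewrite mulrC ler_pdivrMr // (le_trans avu).
have hl0 : 0 < hi - lo by rewrite subr_gt0.
have in01 t : 0 <= t <= 1 -> u <= lo + t * (hi - lo) <= v.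
  move=> /andP[t0 t1].
  have : t * (hi - lo) <= hi - lo by rewrite ler_piMl // ltW.
  have : 0 <= t * (hi - lo) by rewrite mulr_ge0 // ltW.
  by move=> ? ?; apply/andP; split; lra.
have slack : 2 * B * rho <= B * (1 + 2 * rho) by lra.
split.
- rewrite mul0r addr0.
  have := L lo u; rewrite [`|lo - u|]ger0_norm ?subr_ge0 // => /(_ _ _) h.
  have {}h := le_trans (h ltac:(lra) ltac:(lra)) (lip (lo - u) ltac:(lra) ltac:(lra)).
  have -> : f lo = f u + (f lo - f u) by lra.
  by apply: le_trans (ler_normD _ _) _; lra.
- move=> s t s01 t01; apply: le_trans (L _ _ (in01 _ s01) (in01 _ t01)) _.
  have -> : lo + s * (hi - lo) - (lo + t * (hi - lo)) = (hi - lo) * (s - t) by ring.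
  rewrite normrM (gtr0_norm hl0) mulrA ler_wpM2r //.
  by apply: le_trans (lip (hi - lo) _ _) slack; lra.
- move=> s t s01 t01.
  have := cf (lo + s * (hi - lo)) (lo + t * (hi - lo)) 2^-1.
  have /andP[? ?] := in01 _ s01; have /andP[? ?] := in01 _ t01.
  have -> : 2^-1 * (lo + s * (hi - lo)) + (1 - 2^-1) * (lo + t * (hi - lo)) =
     lo + (s + t) / 2 * (hi - lo) by lra.
  move=> h; have {h} := h ltac:(lra) ltac:(lra) ltac:(lra).
  rewrite -(ler_pM2r (ltr0n R 2 : 0 < 2)).
  by rewrite mulr_natr; lra.
Qed.

End ConvexGeometry.

(** * Entropy of a union of blocks of design points *)

Section Design.
Variable R : realType.
Implicit Types (X : nat -> R).

(** The design as a function on all naturals, meaningful below [n], so that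
    indices can be added and subtracted freely. *)
Definition spaced (n : nat) (g1 g2 : R) X : Prop :=
  (forall i, (i < n)%N -> 0 <= X i <= 1) /\
  forall i, (i.+1 < n)%N -> g1 <= X i.+1 - X i <= g2.

Lemma spaced_diff n g1 g2 X i m : spaced n g1 g2 X -> (i + m < n)%N ->
  m%:R * g1 <= X (i + m)%N - X i <= m%:R * g2.
Proof.
move=> [_ sX]; elim: m => [|m IH] im.
  by rewrite addn0 subrr !mul0r lexx.
have := sX (i + m)%N; rewrite -addnS => /(_ im) /andP[? ?].
have /andP[? ?] := IH (ltac:(lia) : (i + m < n)%N).
by rewrite -[m.+1%:R]natr1 !mulrDl !mul1r; apply/andP; split; lra.
Qed.

Lemma small_term_in_window (F : nat -> R) (n s p : nat) (T : R) :
  (forall i, 0 <= F i) -> \sum_(i < n) F i <= T -> (s + p <= n)%N -> (0 < p)%N ->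
  exists2 i, (s <= i < s + p)%N & F i <= T / p%:R.
Proof.
move=> F0 FT spn p0; apply: contrapT => H.
have big i : (s <= i < s + p)%N -> T / p%:R < F i.
  by move=> ip; rewrite ltNge; apply/negP => Fi; apply: H; exists i.
have pR : 0 < p%:R :> R by rewrite ltr0n.
have : \sum_(s <= i < s + p) F i <= T.
  apply: le_trans FT; rewrite -(big_mkord xpredT F).
  have -> : \sum_(0 <= i < n) F i = \sum_(0 <= i < s) F i +
      (\sum_(s <= i < s + p) F i + \sum_(s + p <= i < n) F i).
    by rewrite -!big_cat_nat //=; lia.
  by rewrite addrCA lerDl addr_ge0 // sumr_ge0.
apply/negP; rewrite -ltNge.
have -> : T = \sum_(s <= i < s + p) T / p%:R.
  by rewrite sumr_const_nat addKn -[RHS]mulr_natr divfK // gt_eqF.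
apply: ltr_sum_nat => //; lia.
Qed.

Definition sample_ball n X (alpha : R -> R) (T : R) : set (R -> R) :=
  [set phi | convex01 phi /\ \sum_(i < n) (phi (X i) - alpha (X i)) ^+ 2 <= T].

(** Four windows of [p] indices around the block [[a, a + p)], the two on each
    side being separated by [p] further indices. *)
Lemma windows_order (n a p i1 i2 i3 i4 : nat) :
  (0 < p)%N -> (3 * p <= a)%N -> (a + 4 * p <= n)%N ->
  (a - 3 * p <= i1 < a - 3 * p + p)%N -> (a - p <= i2 < a - p + p)%N ->
  (a + p <= i3 < a + p + p)%N -> (a + 3 * p <= i4 < a + 3 * p + p)%N ->
  [/\ (i1 + p <= i2)%N, (i2 <= a.-1)%N, (i3 + p <= i4)%N, (i4 < n)%N &
      (i3 - i2 <= 3 * p)%N] /\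
  forall i, i \in [:: i1; i2; i3; i4] -> (a - 3 * p <= i < a + 4 * p)%N.
Proof.
move=> p0 pa an h1 h2 h3 h4; split; first by split; lia.
by move=> i; rewrite !inE => /or4P[] /eqP ->; lia.
Qed.

(** In each of the four windows [f - alpha] is somewhere at most
    [sqrt (T / p)] in absolute value. The two points on either side of the
    block are at distance at least [p g1], and the inner two at distance at
    most [3 p g2], so that the ratio [rho] of [lip_convex_rescale] is
    [3 g2 / g1]. *)
Lemma entropy_interior_block n g1 g2 X alpha (a p : nat) (A q T e : R) :
  spaced n g1 g2 X -> 0 < g1 -> 0 < g2 -> (0 < p)%N -> (3 * p <= a)%N ->
  (a + 4 * p <= n)%N ->
  (forall i, (a - 3 * p <= i < a + 4 * p)%N -> alpha (X i) = A * X i + q) ->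
  0 <= T -> 0 < e -> e <= Num.sqrt (T / p%:R) * (1 + 6 * (g2 / g1)) ->
  coded (sample_ball n X alpha T)
    (fun f g => forall i, (a <= i < a + p)%N -> `|f (X i) - g (X i)| <= 11 * e)
    (104 * Num.sqrt (Num.sqrt (T / p%:R) * (1 + 6 * (g2 / g1)) / e)).
Proof.
move=> sX g10 g20 p0 pa an aff T0 e0 eD.
set B := Num.sqrt (T / p%:R); set D := B * _.
have pR : 0 < p%:R :> R by rewrite ltr0n.
(* One point beyond the block on each side, so that [lo < hi] even if [p = 1]. *)
pose lo := X a.-1; pose hi := X (a + p)%N.
have diff i m : (i + m < n)%N -> m%:R * g1 <= X (i + m)%N - X i <= m%:R * g2.
  by apply: spaced_diff.
have mono i j : (i <= j)%N -> (j < n)%N -> X i <= X j.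
  move=> ij jn; have := diff i (j - i)%N; rewrite subnKC // => /(_ jn) /andP[h _].
  by rewrite -subr_ge0; apply: le_trans h; rewrite mulr_ge0 // ltW.
have X01 i : (i < n)%N -> 0 <= X i <= 1 by case: sX => h _; exact: h.
have gap i j : (i + p <= j)%N -> (j < n)%N -> p%:R * g1 <= X j - X i.
  move=> ij jn; have := diff i (j - i)%N; rewrite subnKC; last by lia.
  move=> /(_ jn) /andP[h _]; apply: le_trans h; rewrite ler_wpM2r ?(ltW g10) // ler_nat.
  by lia.
have lohi : lo < hi.
  rewrite -subr_gt0; apply: lt_le_trans (gap _ _ _ _); first by rewrite mulr_gt0.
    by clear -p0 pa; lia.
  by clear -p0 an; lia.
have hl0 : 0 < hi - lo by rewrite subr_gt0.
pose S (phi : R -> R) t := phi (lo + t * (hi - lo)) - (A * (lo + t * (hi - lo)) + q).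
have := @coded_preimage _ _ _ (sample_ball n X alpha T) _ S _ _ (entropy_lip_convex e0 eD).
move=> h; apply: coded_weaken (h _) _ _ _ => //; last first.
  move=> f g _ _ fg i /andP[ai ip].
  have a1i : (a.-1 <= i)%N := leq_trans (leq_pred a) ai.
  have apn : (a + p < n)%N by clear -p0 an; lia.
  have lo_i : lo <= X i by apply: mono => //; exact: ltn_trans ip apn.
  have i_hi : X i <= hi by apply: mono => //; exact: ltnW.
  have := fg ((X i - lo) / (hi - lo)).
  have -> : S f ((X i - lo) / (hi - lo)) - S g ((X i - lo) / (hi - lo)) = f (X i) - g (X i).
    by rewrite /S divfK ?gt_eqF // subrKC; lra.
  apply; apply/andP; split; first by rewrite divr_ge0 // subr_ge0 // ltW.
  by rewrite ler_pdivrMr // mul1r lerD2r.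
move=> f [cf fT].
pose F i := (f (X i) - alpha (X i)) ^+ 2.
have F0 i : 0 <= F i by exact: sqr_ge0.
have fq i : (a - 3 * p <= i < a + 4 * p)%N -> F i <= T / p%:R ->
    `|f (X i) - (A * X i + q)| <= B.
  by move=> /aff <- Fi; rewrite -sqrtr_sqr ler_wsqrtr.
have w1 : (a - 3 * p + p <= n)%N by clear -pa an; lia.
have w2 : (a - p + p <= n)%N by clear -pa an; lia.
have w3 : (a + p + p <= n)%N by clear -pa an; lia.
have w4 : (a + 3 * p + p <= n)%N by clear -pa an; lia.
have [i1 I1 Fi1] := small_term_in_window F0 fT w1 p0.
have [i2 I2 Fi2] := small_term_in_window F0 fT w2 p0.
have [i3 I3 Fi3] := small_term_in_window F0 fT w3 p0.
have [i4 I4 Fi4] := small_term_in_window F0 fT w4 p0.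
have [[i12 i2a i34 i4n i23] irange] := windows_order p0 pa an I1 I2 I3 I4.
have /andP[i3a _] := I3.
have i3n : (i3 < n)%N := leq_ltn_trans (leq_trans (leq_addr _ _) i34) i4n.
have an' : (a + p < n)%N := leq_ltn_trans i3a i3n.
have a1n : (a.-1 < n)%N.
  exact: leq_ltn_trans (leq_pred a) (leq_ltn_trans (leq_addr _ _) an').
have i2n : (i2 < n)%N := leq_ltn_trans i2a a1n.
have i1n : (i1 < n)%N := leq_ltn_trans (leq_trans (leq_addr _ _) i12) i2n.
have i2i3 : (i2 <= i3)%N.
  exact: leq_trans i2a (leq_trans (leq_pred a) (leq_trans (leq_addr _ _) i3a)).
have := @lip_convex_rescale _ (fun y => f y - (A * y + q)) (X i1) (X i2) (X i3) (X i4)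
  lo hi B (p%:R * g1) (3 * (g2 / g1)) (convex01_sub_affine A q cf).
rewrite /D (_ : 6 * (g2 / g1) = 2 * (3 * (g2 / g1))); last by lra.
apply => //.
- by rewrite mulr_gt0.
- by have /andP[] := X01 i1 i1n.
- exact: gap.
- exact: mono.
- exact: mono.
- exact: gap.
- by have /andP[] := X01 i4 i4n.
- have := diff i2 (i3 - i2)%N; rewrite subnKC // => /(_ i3n) /andP[_ i23X].
  apply: le_trans i23X _.
  have -> : 3 * (g2 / g1) * (p%:R * g1) = (3 * p)%:R * g2.
    by rewrite natrM; field; rewrite gt_eqF.
  by rewrite ler_wpM2r ?(ltW g20) // ler_nat.
- by apply: fq => //; apply: irange; rewrite !inE eqxx.
- by apply: fq => //; apply: irange; rewrite !inE eqxx orbT.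
- by apply: fq => //; apply: irange; rewrite !inE eqxx !orbT.
- by apply: fq => //; apply: irange; rewrite !inE eqxx !orbT.
Qed.

(** A block [b] consists of the [b.2] indices from [b.1] on. *)
Definition good_block n X (alpha : R -> R) (b : nat * nat) : Prop :=
  (b.2 = 1%N /\ (b.1 < n)%N) \/
  [/\ (0 < b.2)%N, (3 * b.2 <= b.1)%N, (b.1 + 4 * b.2 <= n)%N &
      exists A q, forall i, (b.1 - 3 * b.2 <= i < b.1 + 4 * b.2)%N ->
        alpha (X i) = A * X i + q].

(** The tolerance is scaled with [T / b.2], the mean square over the block, so
    that the entropy does not depend on the block. *)
Lemma entropy_good_block n g1 g2 X alpha b (T y : R) :
  spaced n g1 g2 X -> 0 < g1 -> 0 < g2 -> good_block n X alpha b ->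
  0 < T -> 1 <= y ->
  coded (sample_ball n X alpha T)
    (fun f g => forall i, (b.1 <= i < b.1 + b.2)%N ->
       (f (X i) - g (X i)) ^+ 2 <= T / b.2%:R / y ^+ 2)
    (104 * Num.sqrt (11 * (1 + 6 * (g2 / g1)) * y)).
Proof.
move=> sX g10 g20 gb T0 y1; have y0 : 0 < y by apply: lt_le_trans y1.
have k1 : 1 <= 1 + 6 * (g2 / g1) by rewrite lerDl mulr_ge0 // divr_ge0 // ltW.
set k := 1 + _ in k1 *.
have sq (p : nat) (d : R) : `|d| <= Num.sqrt (T / p%:R) / y -> d ^+ 2 <= T / p%:R / y ^+ 2.
  move=> h; rewrite -real_normK ?num_real // -[X in X / _ ^+ 2]sqr_sqrtr.
    by rewrite -expr_div_n lerXn2r ?nnegrE // divr_ge0 ?sqrtr_ge0 // ltW.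
  by rewrite divr_ge0 // ltW.
move: gb; rewrite /good_block; case: b => a p /= [[-> an]|[p0 pa pn [A [q aff]]]].
- have sT : 0 < Num.sqrt T by rewrite sqrtr_gt0.
  have e0 : 0 < Num.sqrt T / y by rewrite divr_gt0.
  apply: coded_weaken (coded_range (F := sample_ball n X alpha T)
     (T := fun f => f (X a)) (lo := alpha (X a) - Num.sqrt T) (D := 2 * Num.sqrt T)
     e0 _ _) _ _ _ => //.
  + move=> f [_ fT].
    have : `|f (X a) - alpha (X a)| <= Num.sqrt T.
      rewrite -sqrtr_sqr ler_wsqrtr //; apply: le_trans fT.
      by rewrite (bigD1 (Ordinal an)) //= lerDl sumr_ge0 // => i _; exact: sqr_ge0.
    by rewrite ler_norml => /andP[? ?]; apply/andP; split; lra.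
  + have -> : 2 * Num.sqrt T / (Num.sqrt T / y) = 2 * y.
      by field; rewrite !gt_eqF.
    apply: ler_pM => //; rewrite ?sqrtr_ge0 //; first by lra.
    by rewrite ler_wsqrtr //; nra.
  + move=> f g _ _ fg i ip; have -> : i = a by lia.
    by apply: sq; rewrite divr1.
- have pR : 0 < p%:R :> R by rewrite ltr0n.
  have sT : 0 < Num.sqrt (T / p%:R) by rewrite sqrtr_gt0 divr_gt0.
  have e0 : 0 < Num.sqrt (T / p%:R) / y / 11 by rewrite !divr_gt0.
  have eD : Num.sqrt (T / p%:R) / y / 11 <= Num.sqrt (T / p%:R) * k.
    rewrite -mulrA ler_pM2l // -invfM; apply: le_trans k1.
    by rewrite invf_le1; nra.
  apply: coded_weaken
    (entropy_interior_block sX g10 g20 p0 pa pn aff (ltW T0) e0 eD) _ _ _ => //.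
  + rewrite -/k.
    have -> // : Num.sqrt (T / p%:R) * k / (Num.sqrt (T / p%:R) / y / 11) = 11 * k * y.
    by field; rewrite !gt_eqF.
  + move=> f g _ _ fg i ip; apply: sq; apply: le_trans (fg i ip) _.
    by rewrite mulrC divfK.
Qed.

Lemma entropy_good_blocks n g1 g2 X alpha (bl : seq (nat * nat)) (T y : R) :
  spaced n g1 g2 X -> 0 < g1 -> 0 < g2 ->
  (forall b, b \in bl -> good_block n X alpha b) ->
  (forall i, (i < n)%N -> exists2 b, b \in bl & (b.1 <= i < b.1 + b.2)%N) ->
  0 < T -> 1 <= y ->
  coded (sample_ball n X alpha T)
    (fun f g => \sum_(i < n) (f (X i) - g (X i)) ^+ 2 <=
       (size bl)%:R * (T / y ^+ 2))
    ((size bl)%:R * (104 * Num.sqrt (11 * (1 + 6 * (g2 / g1)) * y))).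
Proof.
move=> sX g10 g20 gbl cov T0 y1; have y0 : 0 < y by apply: lt_le_trans y1.
set h := 104 * _.
have c k : (k < size bl)%N -> coded (sample_ball n X alpha T)
    (fun f g => let b := nth (0, 0) bl k in
       forall i, (b.1 <= i < b.1 + b.2)%N ->
       (f (X i) - g (X i)) ^+ 2 <= T / b.2%:R / y ^+ 2) h.
  by move=> kb; apply: entropy_good_block => //; apply: gbl; rewrite mem_nth.
apply: coded_weaken (coded_all c) _ _ _ => //.
  by rewrite sumr_const card_ord mulr_natl.
move=> f g _ _ fg.
pose F i := (f (X i) - g (X i)) ^+ 2.
have F0 i : 0 <= F i by exact: sqr_ge0.
(* Blocks may overlap: a design point is counted once per block containing it. *)
apply: (@le_trans _ _ (\sum_(i < n) \sum_(b <- bl | (b.1 <= i < b.1 + b.2)%N) F i)).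
  apply: ler_sum => i _; have [b bbl bi] := cov i (ltn_ord i).
  rewrite (big_rem b) //= bi lerDl sumr_ge0 // => *; exact: F0.
rewrite (exchange_big_dep xpredT) //= -sum1_size natr_sum mulr_suml.
rewrite !big_seq; apply: ler_sum => b bbl; rewrite mul1r.
have bP i : (b.1 <= i < b.1 + b.2)%N -> F i <= T / b.2%:R / y ^+ 2.
  by have := fg (index b bl); rewrite index_mem nth_index //; apply.
have [b20|b20] := posnP b.2.
  rewrite big_pred0; last by move=> i; rewrite b20; lia.
  by rewrite divr_ge0 ?sqr_ge0 // ltW.
have b2R : 0 < b.2%:R :> R by rewrite ltr0n.
rewrite (_ : T / y ^+ 2 = b.2%:R * (T / b.2%:R / y ^+ 2)); last first.
  by field; rewrite !gt_eqF.
have cst0 : 0 <= T / b.2%:R / y ^+ 2 by rewrite !divr_ge0 ?sqr_ge0 // ltW.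
apply: (@le_trans _ _ (\sum_(i < n | (b.1 <= i < b.1 + b.2)%N) (T / b.2%:R / y ^+ 2))).
  by apply: ler_sum => i; exact: bP.
rewrite sumr_const -[leLHS]mulr_natl ler_wpM2r // ler_nat.
rewrite -[leqRHS]card_ord.
have inj : {in [pred i : 'I_n | (b.1 <= i < b.1 + b.2)%N] &,
    injective (fun i : 'I_n => insubd (Ordinal b20) (i - b.1)%N)}.
  move=> i j /andP[? ?] /andP[? ?] /(congr1 val); rewrite !val_insubd.
  have -> : (i - b.1 < b.2)%N by lia.
  have -> : (j - b.1 < b.2)%N by lia.
  by move=> ij; apply: val_inj => /=; lia.
by rewrite -(card_in_image inj) max_card.
Qed.

End Design.

(** * Decomposition of the pieces into blocks *)

Section Whitney.
Variable R : realType.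

(** A single index, or a run of indices whose distance to both ends of the
    interval [[s, e)] is at least three times its length. *)
Definition whitney_block (s e : nat) (b : nat * nat) : Prop :=
  (s <= b.1)%N /\ (b.1 + b.2 <= e)%N /\
  (b.2 = 1%N \/
   [/\ (0 < b.2)%N, (s + 3 * b.2 <= b.1)%N & (b.1 + 4 * b.2 <= e)%N]).

Definition tiles (bl : seq (nat * nat)) (s e : nat) : Prop :=
  forall i, (s <= i < e)%N -> exists2 b, b \in bl & (b.1 <= i < b.1 + b.2)%N.

(** Each block removes at least one eighth of what remains, and
    [ln (7/8) <= - 1/8]: this pays for one block. *)
Lemma ln_quarter_step (h : nat) : (4 <= h)%N ->
  8 * ln ((h - h %/ 4)%N%:R : R) + 1 <= 8 * ln (h%:R : R).
Proof.
move=> h4; have hR : 0 < h%:R :> R by rewrite ltr0n; lia.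
have le : ((h - h %/ 4)%N%:R : R) <= h%:R * (7 / 8).
  have : (8 * (h - h %/ 4) <= 7 * h)%N by lia.
  by rewrite -(ler_nat R) !natrM; lra.
have pos : 0 < ((h - h %/ 4)%N%:R : R) by rewrite ltr0n; lia.
have : ln ((h - h %/ 4)%N%:R : R) <= ln (h%:R * (7 / 8)) by rewrite ler_ln ?posrE ?mulr_gt0.
rewrite lnM ?posrE //.
have := @le_ln1Dx R (- (1 / 8)); rewrite (_ : 1 + - (1 / 8) = 7 / 8 :> R); last by lra.
move=> /(_ ltac:(lra)); lra.
Qed.

(** Blocks are peeled off from the middle towards the left end: the last
    quarter of [[s, s + h)] lies at distance at least three times its length
    from [s], and also from [e] since [h] is at most half of the interval. *)
Lemma whitney_left (s e h : nat) : (s + 2 * h <= e)%N ->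
  exists bl, [/\ forall b, b \in bl -> whitney_block s e b,
    tiles bl s (s + h) & (size bl)%:R <= 3 + 8 * ln (h%:R : R)].
Proof.
elim/ltn_ind: h => h IH he.
have [h4|h4] := ltnP h 4.
  exists [seq (s + i, 1)%N | i <- iota 0 h]; split.
  - move=> b /mapP[i]; rewrite mem_iota /whitney_block => /andP[_ ih] -> /=.
    by split; [|split; [|left]] => //; lia.
  - move=> i si; exists (i, 1%N); last by rewrite /=; lia.
    by apply/mapP; exists (i - s)%N; rewrite ?mem_iota ?subnKC //; lia.
  - rewrite size_map size_iota; have : (h%:R : R) <= 3 by rewrite ler_nat; lia.
    have : 0 <= ln (h%:R : R).
      case: (posnP h) => [->|h0]; first by rewrite ln0.
      by rewrite ln_ge0 // ler1n.
    lra.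
have [bl [wbl tbl sbl]] := IH (h - h %/ 4)%N ltac:(lia) ltac:(lia).
exists ((s + (h - h %/ 4), h %/ 4)%N :: bl); split.
- move=> b; rewrite inE => /orP[/eqP ->|/wbl //]; rewrite /whitney_block /=.
  by split; [|split; [|right; split]]; lia.
- move=> i si; have [ilt|ige] := ltnP i (s + (h - h %/ 4)).
    by have [b bbl bi] := tbl i ltac:(lia); exists b => //; rewrite inE bbl orbT.
  by exists (s + (h - h %/ 4), h %/ 4)%N; rewrite ?inE ?eqxx //=; lia.
- by rewrite /= -natr1; have := ln_quarter_step h4; lra.
Qed.

(** The mirror image of [whitney_left]; [h] may exceed half of the interval by
    one half, which absorbs the parity of its length. *)
Lemma whitney_right (s e h : nat) : (s + 2 * h <= e.+1)%N -> (h <= e)%N ->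
  exists bl, [/\ forall b, b \in bl -> whitney_block s e b,
    tiles bl (e - h) e & (size bl)%:R <= 3 + 8 * ln (h%:R : R)].
Proof.
elim/ltn_ind: h => h IH he hle.
have [h4|h4] := ltnP h 4.
  exists [seq (e - h + i, 1)%N | i <- iota 0 h]; split.
  - move=> b /mapP[i]; rewrite mem_iota /whitney_block => /andP[_ ih] -> /=.
    by split; [|split; [|left]] => //; lia.
  - move=> i si; exists (i, 1%N); last by rewrite /=; lia.
    by apply/mapP; exists (i - (e - h))%N; rewrite ?mem_iota ?subnKC //; lia.
  - rewrite size_map size_iota; have : (h%:R : R) <= 3 by rewrite ler_nat; lia.
    have : 0 <= ln (h%:R : R).
      case: (posnP h) => [->|h0]; first by rewrite ln0.
      by rewrite ln_ge0 // ler1n.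
    lra.
have [bl [wbl tbl sbl]] := IH (h - h %/ 4)%N ltac:(lia) ltac:(lia) ltac:(lia).
exists ((e - h, h %/ 4)%N :: bl); split.
- move=> b; rewrite inE => /orP[/eqP ->|/wbl //]; rewrite /whitney_block /=.
  by split; [|split; [|right; split]]; lia.
- move=> i si; have [ilt|ige] := ltnP i (e - (h - h %/ 4)).
    by exists (e - h, h %/ 4)%N; rewrite ?inE ?eqxx //=; lia.
  by have [b bbl bi] := tbl i ltac:(lia); exists b => //; rewrite inE bbl orbT.
- by rewrite /= -natr1; have := ln_quarter_step h4; lra.
Qed.

Lemma whitney (s e n : nat) : (s <= e)%N -> (e <= n)%N -> (0 < n)%N ->
  exists bl, [/\ forall b, b \in bl -> whitney_block s e b,
    tiles bl s e & (size bl)%:R <= 6 + 16 * ln (n%:R : R)].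
Proof.
move=> se en n0; pose h := ((e - s) %/ 2)%N.
have [bl [wl tl sl]] := @whitney_left s e h ltac:(rewrite /h; lia).
have [br [wr tr sr]] := @whitney_right s e (e - s - h)%N
  ltac:(rewrite /h; lia) ltac:(rewrite /h; lia).
have lnn k : (k <= n)%N -> ln (k%:R : R) <= ln (n%:R : R).
  move=> kn; case: (posnP k) => [->|k0]; first by rewrite ln0 // ln_ge0 // ler1n.
  by rewrite ler_ln ?posrE ?ltr0n // ler_nat.
exists (bl ++ br); split.
- by move=> b; rewrite mem_cat => /orP[/wl|/wr].
- move=> i si; have [ilt|ige] := ltnP i (s + h).
    by have [b bb bi] := tl i ltac:(lia); exists b => //; rewrite mem_cat bb.
  by have [b bb bi] := tr i ltac:(lia); exists b => //; rewrite mem_cat bb orbT.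
- rewrite size_cat natrD.
  have := lnn h ltac:(rewrite /h; lia); have := lnn (e - s - h)%N ltac:(lia).
  lra.
Qed.

(** The pieces are treated from left to right; for [i > 0] the index [m]
    separates the design points up to the breakpoint [t i] from those beyond. *)
Lemma good_blocks_of_pieces n (g1 g2 : R) X alpha k : spaced n g1 g2 X ->
  0 < g1 -> (0 < n)%N -> has_affine_pieces alpha k ->
  exists bl, [/\ forall b, b \in bl -> good_block n X alpha b,
    forall i, (i < n)%N -> exists2 b, b \in bl & (b.1 <= i < b.1 + b.2)%N &
    (size bl)%:R <= k%:R * (6 + 16 * ln (n%:R : R))].
Proof.
move=> sX g10 n0 [t [t0 tk tmon taff]].
have X01 i : (i < n)%N -> 0 <= X i <= 1 by case: sX => h _; exact: h.
have mono i j : (i <= j)%N -> (j < n)%N -> X i <= X j.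
  move=> ij jn; have := spaced_diff (i := i) (m := (j - i)%N) sX.
  rewrite subnKC // => /(_ jn) /andP[h _].
  by rewrite -subr_ge0; apply: le_trans h; rewrite mulr_ge0 // ltW.
have step i : (i <= k)%N -> exists m bl, [/\ (m <= n)%N,
    (0 < i)%N -> (m < n)%N -> t i < X m,
    forall b, b \in bl -> good_block n X alpha b,
    tiles bl 0 m & (size bl)%:R <= i%:R * (6 + 16 * ln (n%:R : R))].
  elim: i => [_|i IH ik].
    by exists 0%N, [::]; split => //; rewrite mul0r.
  have [m [bl [mn tm gbl tbl sbl]]] := IH (ltnW ik).
  (* The next piece ends before the first [m' >= m] with [t i.+1 < X m']. *)
  have exm : exists m', (m <= m')%N && ((m' == n) || (t i.+1 < X m')).
    by exists n; rewrite mn eqxx.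
  have [m' /andP[mm' Pm'] minm'] := ex_minnP exm.
  have m'n : (m' <= n)%N by apply: minm'; rewrite mn eqxx.
  have [wbl [gw tw sw]] := @whitney m m' n mm' m'n n0.
  exists m', (bl ++ wbl); split => //.
  - by move=> _ m'n'; move: Pm'; rewrite ltn_eqF.
  - move=> b; rewrite mem_cat => /orP[/gbl //|/gw].
    rewrite /whitney_block => -[mb [bm' [b1|[b0 mb3 bm'4]]]]; first by left; split=> //; lia.
    right; split => //; first by lia.
      by lia.
    have [A [q aff]] := taff i ik; exists A, q => j jb; apply: aff.
    have mj : (m <= j)%N by clear -jb mb3; lia.
    have jm' : (j < m')%N by clear -jb bm'4; lia.
    have jn : (j < n)%N by exact: leq_trans jm' m'n.
    apply/andP; split.
      case: i {IH ik exm minm' Pm' sbl} tm => [|i] tm.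
        by rewrite t0; case/andP: (X01 _ jn).
      apply: le_trans (mono _ _ mj jn); apply: ltW; apply: tm => //.
      exact: leq_ltn_trans mj jn.
    rewrite leNgt; apply/negP => tj.
    by have := minm' j; rewrite mj tj orbT => /(_ isT); rewrite leqNgt jm'.
  - move=> j /andP[_ jm']; have [jm|mj] := ltnP j m.
      by have [b bb bj] := tbl j jm; exists b => //; rewrite mem_cat bb.
    by have [b bb bj] := tw j ltac:(by rewrite mj jm'); exists b => //; rewrite mem_cat bb orbT.
  - by rewrite size_cat natrD -[i.+1%:R]natr1 mulrDl mul1r lerD.
have [m [bl [mn tm gbl tbl sbl]]] := step k (leqnn k).
exists bl; split => // i iN; apply: tbl; rewrite /=.
suff -> : m = n by [].
apply/eqP; rewrite eqn_leq mn /= leqNgt; apply/negP => mlt.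
case: k {step sbl tmon taff} tk tm => [|k] tk tm.
  by move: (oner_neq0 R); rewrite -tk t0 eqxx.
have := tm isT mlt; rewrite tk; case/andP: (X01 _ mlt) => _.
by move=> /le_lt_trans h /h; rewrite ltxx.
Qed.

End Whitney.

(** * The entropy bound *)

Section Assembly.
Variable R : realType.

Lemma spaced_of_design n (c1 c2 : R) (x : 'I_n -> R) : (0 < n)%N ->
  design c1 c2 x -> exists2 X : nat -> R,
    spaced n (c1 / n%:R) (c2 / n%:R) X & forall i : 'I_n, X i = x i.
Proof.
move=> n0 [x01 _ gap]; have nR : 0 < n%:R :> R by rewrite ltr0n.
pose X i := if insub i is Some j then x j else 0.
have XE (i : 'I_n) : X i = x i by rewrite /X valK.
exists X => //; split.
  by move=> i ilt; rewrite (XE (Ordinal ilt)); exact: x01.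
move=> i ilt; have := gap (Ordinal (ltnW ilt)) (Ordinal ilt) erefl.
rewrite -(XE (Ordinal ilt)) -(XE (Ordinal (ltnW ilt))) /=.
by rewrite ler_pdivrMr // ler_pdivlMr // mulrC.
Qed.

(** As [n] points of [0,1] have gaps at least [c1 / n], [c1 <= 2], so the
    logarithmic factor is at least [1 + ln n - 2 ln 2]. This dominates [ln n]
    up to a constant because [ln 2 <= 4/5] and [n >= 2]. *)
Lemma log_factor_bound n (c1 g2 : R) X : (2 <= n)%N -> 0 < c1 ->
  spaced n (c1 / n%:R) g2 X ->
  6 + 16 * ln (n%:R : R) <= 112 * ln (expR 1 * n%:R / (2 * c1)).
Proof.
move=> n2 c0 sX; have nR : 0 < n%:R :> R by rewrite ltr0n; lia.
have c2 : c1 <= 2.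
  have := spaced_diff (i := 0%N) (m := n.-1) sX; rewrite add0n => /(_ ltac:(lia)) /andP[h _].
  have /andP[X0 _] := sX.1 0%N ltac:(lia).
  have /andP[_ X1] := sX.1 n.-1 ltac:(lia).
  have {}h : n.-1%:R * (c1 / n%:R) <= 1 by apply: le_trans h _; lra.
  rewrite mulrA ler_pdivrMr // mul1r in h.
  have n1 : (n%:R : R) <= 2 * n.-1%:R by rewrite -natrM ler_nat; lia.
  rewrite -(ler_pM2l nR); apply: le_trans (_ : 2 * n.-1%:R * c1 <= _).
    by rewrite ler_wpM2r // ltW.
  lra.
have l2 : ln (n%:R : R) >= ln 2 by rewrite ler_ln ?posrE // ler_nat.
have ln2_lb : 1 / 2 <= ln (2 : R).
  have := @le_ln1Dx R (- (1 / 2)); rewrite (_ : 1 + - (1 / 2) = 2^-1 :> R); last by lra.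
  by rewrite lnV ?posrE // => /(_ ltac:(lra)); lra.
have ln2_ub : ln (2 : R) <= 4 / 5.
  rewrite -[leRHS]expRK ler_ln ?posrE ?expR_gt0 //.
  (* [2 <= (1 + 1/5)^4 <= exp (4/5)]. *)
  have -> : 4 / 5 = 4%:R * (1 / 5) :> R by lra.
  rewrite expRM_natl; apply: (@le_trans _ _ ((1 + 1 / 5) ^+ 4)); first by rewrite !exprS expr0; lra.
  by rewrite lerXn2r ?nnegrE ?expR_ge0 ?expR_ge1Dx //; lra.
have : ln (expR 1 * n%:R / (2 * c1)) >= 1 + ln (n%:R : R) - 2 * ln 2.
  rewrite ln_div ?posrE ?mulr_gt0 ?expR_gt0 // !lnM ?posrE ?expR_gt0 // expRK.
  have : ln c1 <= ln 2 by rewrite ler_ln ?posrE.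
  lra.
lra.
Qed.

Lemma ell2E n (x : 'I_n -> R) X (f g : R -> R) : (forall i : 'I_n, X i = x i) ->
  (0 < n)%N -> \sum_(i < n) (f (X i) - g (X i)) ^+ 2 = n%:R * ell2 x f g.
Proof.
move=> XE n0; rewrite /ell2 mulrA divff ?pnatr_eq0 -?lt0n // mul1r.
by apply: eq_bigr => i _; rewrite XE.
Qed.

Lemma ell2_ge0 n (x : 'I_n -> R) (f g : R -> R) : 0 <= ell2 x f g.
Proof. by rewrite mulr_ge0 ?invr_ge0 // sumr_ge0 // => i _; exact: sqr_ge0. Qed.

Lemma ell2_relaxed_triangle n (x : 'I_n -> R) (f g h : R -> R) :
  ell2 x f h <= 2 * (ell2 x f g + ell2 x g h).
Proof.
rewrite /ell2 -mulrDr mulrCA ler_wpM2l ?invr_ge0 // -big_split /= mulr_sumr.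
apply: ler_sum => i _; rewrite -subr_ge0.
have -> : 2 * ((f (x i) - g (x i)) ^+ 2 + (g (x i) - h (x i)) ^+ 2) -
   (f (x i) - h (x i)) ^+ 2 = (f (x i) - 2 * g (x i) + h (x i)) ^+ 2 by ring.
exact: sqr_ge0.
Qed.

(** [y] is the ratio of the amplitude of [phi - alpha] to the error allowed on
    a block, which is the same for all blocks when each of them receives the
    share [1 / K] of the squared error. *)
Lemma entropy_ball_pieces n (c1 c2 : R) (x : 'I_n -> R) phi0 alpha k (r eps : R) :
  (2 <= n)%N -> 0 < c1 -> 0 < c2 -> design c1 c2 x ->
  0 < eps -> eps < r -> (0 < k)%N -> has_affine_pieces alpha k ->
  let K := k%:R * (6 + 16 * ln (n%:R : R)) in
  let y := Num.sqrt K * Num.sqrt (2 * (r ^+ 2 + ell2 x phi0 alpha)) / eps in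
  coded (convex_ball x phi0 r) (fun f g => ell x f g <= eps)
    (K * (104 * Num.sqrt (11 * (1 + 6 * (c2 / c1)) * y))).
Proof.
move=> n2 c10 c20 dx e0 er k0 pieces K y.
have n0 : (0 < n)%N by exact: ltnW.
have nR : 0 < n%:R :> R by rewrite ltr0n.
have [X sX XE] := spaced_of_design n0 dx.
have g10 : 0 < c1 / n%:R by rewrite divr_gt0.
have g20 : 0 < c2 / n%:R by rewrite divr_gt0.
have [bl [gbl cov szbl]] := good_blocks_of_pieces sX g10 n0 pieces.
set Q := r ^+ 2 + _ in y *.
have r2 : eps ^+ 2 <= r ^+ 2 by rewrite lerXn2r ?nnegrE ?ltW // (lt_trans e0).
have Q0 : eps ^+ 2 <= Q by apply: le_trans r2 _; rewrite lerDl ell2_ge0.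
have Qpos : 0 < Q by apply: lt_le_trans Q0; rewrite exprn_gt0.
have lnn : 0 <= ln (n%:R : R) by rewrite ln_ge0 // ler1n.
have K1 : 1 <= K.
  have : (1 : R) <= k%:R by rewrite ler1n.
  by rewrite /K => ?; apply: mulr_ege1 => //; lra.
have y1 : 1 <= y.
  rewrite /y ler_pdivlMr // mul1r -sqrtrM; last by apply: le_trans K1.
  rewrite -[eps]gtr0_norm // -sqrtr_sqr ler_wsqrtr //; apply: le_trans Q0 _.
  have : Q <= K * Q by rewrite ler_peMl // ltW.
  lra.
have T0 : 0 < n%:R * (2 * Q) by rewrite !mulr_gt0.
have y0 : 0 < y by apply: lt_le_trans y1.
have y2 : y ^+ 2 = K * (2 * Q) / eps ^+ 2.
  rewrite /y expr_div_n exprMn !sqr_sqrtr //; last by apply: le_trans K1.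
  by rewrite mulr_ge0 // ltW.
have -> : c2 / c1 = c2 / n%:R / (c1 / n%:R) by field; rewrite !gt_eqF.
apply: coded_weaken (entropy_good_blocks sX g10 g20 gbl cov T0 y1) _ _ _.
- move=> f [cf fr]; split => //; rewrite (ell2E f alpha XE n0) ler_pM2l //.
  apply: le_trans (ell2_relaxed_triangle x f phi0 alpha) _.
  by rewrite ler_pM2l // lerD2r.
- by rewrite ler_wpM2r // mulr_ge0 // sqrtr_ge0.
- move=> f g _ _; rewrite (ell2E f g XE n0) => h.
  rewrite /ell -[leRHS]gtr0_norm // -sqrtr_sqr ler_wsqrtr // -(ler_pM2l nR).
  apply: le_trans h _; rewrite y2.
  have -> : n%:R * (2 * Q) / (K * (2 * Q) / eps ^+ 2) = n%:R * eps ^+ 2 / K.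
    by field; rewrite !gt_eqF // (lt_le_trans _ K1).
  rewrite mulrA ler_pdivrMr ?(lt_le_trans _ K1) // mulrC ler_wpM2l //.
  by rewrite mulr_ge0 // sqr_ge0.
Qed.

Lemma num_piecesP (alpha : R -> R) : pw_affine_convex alpha ->
  has_affine_pieces alpha (num_pieces alpha) /\ (0 < num_pieces alpha)%N.
Proof.
move=> [_ [k0 hk0]].
have [h _] : has_affine_pieces alpha (num_pieces alpha) /\
    forall m, has_affine_pieces alpha m -> (num_pieces alpha <= m)%N.
  apply: (@xgetPex _ 0%N [set k | has_affine_pieces alpha k /\
                    forall m, has_affine_pieces alpha m -> (k <= m)%N]).
  have ex : exists k, `[< has_affine_pieces alpha k >] by exists k0; apply/asboolP.
  have [k /asboolP hk mink] := ex_minnP ex.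
  by exists k; split => // m hm; apply: mink; apply/asboolP.
split => //; case: (num_pieces alpha) h => // -[t [t0 t1 _ _]].
by move: (oner_neq0 R); rewrite -t1 t0 eqxx.
Qed.

Lemma pw_affine_convex0 : @pw_affine_convex R (fun=> 0).
Proof.
split.
  by move=> t a b _ _; rewrite convmm.
exists 1%N, (fun i => i%:R); split => // -[|//] _ //.
by exists 0, 0 => y _; rewrite mul0r addr0.
Qed.

(** Moves the infimum inside the square root without continuity: the
    inequality is solved for [G] instead. *)
Lemma le_sqrt_inf (E : set R) (v A eps : R) : 0 < A -> 0 < eps -> E !=set0 ->
  (forall G, E G -> v <= A * Num.sqrt (G / eps)) ->
  v <= A * Num.sqrt (inf E / eps).
Proof.
move=> A0 e0 E0 vE; have [v0|v0] := leP v 0.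
  by apply: le_trans v0 _; rewrite mulr_ge0 ?sqrtr_ge0 // ltW.
have lb : (v / A) ^+ 2 * eps <= inf E.
  apply: lb_le_inf => // G /vE vG; rewrite -ler_pdivlMr //.
  rewrite mulrC -ler_pdivrMr // in vG.
  have s0 : 0 < Num.sqrt (G / eps) by apply: lt_le_trans vG; rewrite divr_gt0.
  rewrite -[leRHS]sqr_sqrtr; last by rewrite ltW // -sqrtr_gt0.
  have vA0 : 0 < v / A by rewrite divr_gt0.
  by rewrite lerXn2r // nnegrE ltW.
rewrite -ler_pdivrMl // mulrC -[leLHS]gtr0_norm ?divr_gt0 // -sqrtr_sqr ler_wsqrtr //.
by rewrite ler_pdivlMr.
Qed.

Lemma lne_covering_number X (eps h : R) (F : set X) (rho : X -> X -> R) N :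
  Defs.covered_by rho eps F N -> N%:R <= expR h ->
  (lne (covering_number eps F rho) <= h%:E)%E.
Proof.
move=> cov Nh.
have le : (covering_number eps F rho <= (expR h)%:E)%E.
  apply: (@le_trans _ _ (N%:R)%:E); last by rewrite lee_fin.
  by apply: ereal_inf_lbound; exists N.
have ge : (0 <= covering_number eps F rho)%E.
  by apply: le_ereal_inf_tmp => _ [M _ <-]; rewrite lee_fin.
rewrite -[h]expRK -lne_EFin ?expR_gt0 // lee_lne //.
  by rewrite in_itv /= ge leey.
by rewrite in_itv /= lee_fin expR_ge0 leey.
Qed.

(** The source of the exponent 5/4: [K] blocks, each of entropy
    [O(sqrt (sqrt K))]. *)
Lemma powR_five_quarters (a : R) : 0 <= a -> a * Num.sqrt (Num.sqrt a) = a `^ (5 / 4).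
Proof.
rewrite le_eqVlt => /predU1P[<-|a0]; first by rewrite mul0r powR0 //; lra.
rewrite -!powR12_sqrt ?powR_ge0 ?ltW // -powRrM -{1}[a]powRr1 ?ltW // -powRD.
  by congr (_ `^ _); lra.
by apply/implyP => _; rewrite gt_eqF.
Qed.

Lemma sqrt_powR_five_halves (a z : R) : 0 <= a ->
  Num.sqrt (a `^ (5 / 2) * z) = a `^ (5 / 4) * Num.sqrt z.
Proof.
move=> a0; rewrite sqrtrM ?powR_ge0 // -powR12_sqrt ?powR_ge0 // -powRrM.
by congr (_ `^ _ * _); lra.
Qed.

Lemma entropy_bound_algebra (k L Lam kappa Q eps : R) :
  0 <= k -> 0 <= L -> L <= 112 * Lam -> 0 <= kappa -> 0 <= Q -> 0 < eps ->
  k * L * (104 * Num.sqrt (11 * kappa * (Num.sqrt (k * L) * Num.sqrt (2 * Q) / eps))) <=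
  104 * Num.sqrt (11 * kappa * Num.sqrt 2) * 112 `^ (5 / 4) * Lam `^ (5 / 4) *
    Num.sqrt (k `^ (5 / 2) * Num.sqrt Q / eps).
Proof.
move=> k0 L0 LL kap0 Q0 e0.
have kL0 : 0 <= k * L by rewrite mulr_ge0.
have Lam0 : 0 <= Lam by rewrite -(pmulr_rge0 _ (ltr0n R 112)); exact: le_trans LL.
rewrite -[k `^ _ * _ / _]mulrA sqrt_powR_five_halves //.
have -> : 11 * kappa * (Num.sqrt (k * L) * Num.sqrt (2 * Q) / eps) =
   (11 * kappa * Num.sqrt 2) * (Num.sqrt (k * L) * (Num.sqrt Q / eps)).
  by rewrite (sqrtrM Q (ler0n R 2)); ring.
have c0 : 0 <= 11 * kappa * Num.sqrt 2 by rewrite !mulr_ge0 ?sqrtr_ge0.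
rewrite (sqrtrM _ c0) (sqrtrM _ (sqrtr_ge0 _)).
set C := Num.sqrt (11 * _ * _); set z := Num.sqrt (Num.sqrt Q / eps).
have -> : k * L * (104 * (C * (Num.sqrt (Num.sqrt (k * L)) * z))) =
   104 * C * z * (k * L * Num.sqrt (Num.sqrt (k * L))) by ring.
rewrite powR_five_quarters // powRM //.
have -> : 104 * C * 112 `^ (5 / 4) * Lam `^ (5 / 4) * (k `^ (5 / 4) * z) =
   104 * C * z * (k `^ (5 / 4) * (112 `^ (5 / 4) * Lam `^ (5 / 4))) by ring.
rewrite -[112 `^ _ * _]powRM //; apply: ler_wpM2l; first by rewrite !mulr_ge0 ?sqrtr_ge0.
apply: ler_wpM2l; first exact: powR_ge0.
by apply: ge0_ler_powR; rewrite ?nnegrE ?mulr_ge0 //; lra.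
Qed.

End Assembly.

Unset Implicit Arguments.

Theorem theorem3p1 (R : realType) (ratio : R) (ratio_gt0 : 0 < ratio) :
  exists c : R, 0 < c /\
    forall (n : nat) (c1 c2 : R) (x : 'I_n -> R),
      (2 <= n)%N -> 0 < c1 -> 0 < c2 -> c1 / c2 = ratio ->
      design c1 c2 x ->
      forall (phi0 : R -> R) (r eps : R),
        convex01 phi0 -> 0 < r -> 0 < eps ->
        (lne (covering_number eps (convex_ball x phi0 r) (ell x)) <=
         (c * ln (expR 1 * n%:R / (2 * c1)) `^ (5 / 4) *
          Num.sqrt (Gamma x r phi0 / eps))%:E)%E.
Proof.
pose kappa := 1 + 6 / ratio.
have kappa0 : 0 < kappa by rewrite addr_gt0 // divr_gt0.
pose c := 104 * Num.sqrt (11 * kappa * Num.sqrt 2) * 112 `^ (5 / 4).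
have c0 : 0 < c by rewrite !mulr_gt0 ?powR_gt0 // sqrtr_gt0 !mulr_gt0 ?sqrtr_gt0.
exists c; split => // n c1 c2 x n2 c10 c20 cr dx phi0 r eps cphi0 r0 e0.
have n0 : (0 < n)%N by exact: ltnW.
have [X sX _] := spaced_of_design n0 dx.
set Lam := ln (_ / _).
have LamL : 6 + 16 * ln (n%:R : R) <= 112 * Lam := log_factor_bound n2 c10 sX.
have lnn : 0 <= ln (n%:R : R) by rewrite ln_ge0 // ler1n.
have Lam0 : 0 < Lam by lra.
have A0 : 0 < c * Lam `^ (5 / 4) by rewrite mulr_gt0 // powR_gt0.
(* If [r <= eps] a single ball around [phi0] suffices. *)
have [re|er] := leP r eps.
  have rhs0 : 0 <= c * Lam `^ (5 / 4) * Num.sqrt (Gamma x r phi0 / eps).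
    by rewrite mulr_ge0 ?sqrtr_ge0 // ltW.
  apply: (@lne_covering_number _ _ _ _ _ _ 1); last first.
    by apply: le_trans (expR_ge1Dx _); rewrite lerDl.
  exists (fun=> phi0) => f [_ fr]; exists ord0 => //=.
  rewrite /ell -[leRHS]gtr0_norm // -sqrtr_sqr ler_wsqrtr //.
  have -> : ell2 x phi0 f = ell2 x f phi0.
    by rewrite /ell2; congr (_ * _); apply: eq_bigr => i _; rewrite -sqrrN opprB.
  by apply: le_trans fr _; rewrite lerXn2r // nnegrE ltW.
have ball0 : convex_ball x phi0 r !=set0.
  exists phi0; split => //; rewrite /ell2 big1 ?mulr0 ?sqr_ge0 // => i _.
  by rewrite subrr expr0n.
have bound alpha : pw_affine_convex alpha ->
    (lne (covering_number eps (convex_ball x phi0 r) (ell x)) <=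
     (c * Lam `^ (5 / 4) * Num.sqrt ((num_pieces alpha)%:R `^ (5 / 2) *
           Num.sqrt (r ^+ 2 + ell2 x phi0 alpha) / eps))%:E)%E.
  move=> /num_piecesP[pieces k0].
  have ent := entropy_ball_pieces phi0 n2 c10 c20 dx e0 er k0 pieces.
  have [N covN Nle] := covered_by_coded ball0 ent.
  apply: le_trans (lne_covering_number covN Nle) _; rewrite lee_fin.
  have -> : 1 + 6 * (c2 / c1) = kappa.
    by rewrite /kappa -cr; field; rewrite !gt_eqF.
  apply: entropy_bound_algebra => //; first by lra.
    exact: ltW.
  by rewrite addr_ge0 ?sqr_ge0 ?ell2_ge0.
have := bound; case: (lne _) => [v|/(_ _ (pw_affine_convex0 R))|_]; last by rewrite leNye.
  move=> {}bound; rewrite lee_fin; apply: le_sqrt_inf => //.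
    by exists (((num_pieces (fun=> 0 : R))%:R : R) `^ (5 / 2) *
       Num.sqrt (r ^+ 2 + ell2 x phi0 (fun=> 0))), (fun=> 0) => //; exact: pw_affine_convex0.
  by move=> _ [alpha /bound + <-]; rewrite lee_fin.
by [].
Qed.
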